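(* Let $F$ be holomorphic in a neighbourhood of a point $\rho=\beta+i\gamma\in\mathbb{C}$ ($\beta,\gamma\in\mathbb{R}$) and suppose that $\rho$ is a zero of $F$ of (finite) order $m\ge 1$. Put $$u_\sigma(t)=\operatorname{Re}\frac{F'(\sigma+it)}{F(\sigma+it)}\qquad(\sigma,t\in\mathbb{R})$$ wherever the expression is defined. Then for all sufficiently small $a>0$, $$\frac{d^2}{dt^2}u_{\beta-a}(t)\Big|_{t=\gamma}>0,\qquad \frac{d^2}{dt^2}u_{\beta+a}(t)\Big|_{t=\gamma}<0 .$$ Consequently, no open two-sided vertical strip containing $\rho$ can support strict vertical concavity of $\operatorname{Re}(F'/F)$ on both sides of the zero; that is, for no $\delta>0$ is it true that for every $\sigma\in(\beta-\delta,\beta+\delta)$ with $\sigma\neq\beta$ the function $t\mapsto u_\sigma(t)$ is strictly concave on every interval on which it is defined.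
   Context: The derivative $F'$ is the complex derivative of $F$; $u_\sigma(t)$ is defined at those $(\sigma,t)$ for which $\sigma+it$ lies in the domain of $F$ and $F(\sigma+it)\neq0$. ''Vertical'' concavity means concavity in the variable $t$ for fixed $\sigma$. *)

(* Defs.v *)
From Stdlib Require Import Reals.
From Coquelicot Require Import Coquelicot.
Open Scope R_scope.

(* [U] plays the role of the domain of [F]; the values of [F] outside [U] are
   irrelevant.  Differentiability is complex: the scalar field is
   [C_AbsRing]. *)
Definition holomorphic_on (U : C -> Prop) (F : C -> C) : Prop :=
  open U /\ forall z : C, U z -> @ex_derive C_AbsRing C_NormedModule F z.

(* [F z = (z - rho) ^ m * g z] near [rho], with [g] holomorphic near [rho] and
   [g rho <> 0]. *)
Definition zero_of_order (F : C -> C) (rho : C) (m : nat) : Prop :=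
  (1 <= m)%nat /\
  exists (V : C -> Prop) (g : C -> C),
    V rho /\ holomorphic_on V g /\ g rho <> 0%C /\
    forall z : C, V z -> F z = ((z - rho) ^ m * g z)%C.

Definition point (sigma t : R) : C := (sigma + Ci * t)%C.

(* [C_derive] and division are total, so [u] is only meaningful where
   [u_defined] holds. *)
Definition u (F : C -> C) (sigma t : R) : R :=
  Re (C_derive F (point sigma t) / F (point sigma t))%C.

Definition u_defined (U : C -> Prop) (F : C -> C) (sigma t : R) : Prop :=
  U (point sigma t) /\ F (point sigma t) <> 0%C.

(* Twice differentiability at [x] of a partial function, given by a total [f]
   and its domain [D].  [ex_derive_n f 2 x] alone does not say that [f] is
   differentiable around [x], because [Derive] is total. *)
Definition twice_derivable_at (D : R -> Prop) (f : R -> R) (x : R) : Prop :=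
  locally x (fun t => D t /\ ex_derive f t) /\ ex_derive_n f 2 x.

(* Arbitrary intervals: open, closed, half-open, bounded or not. *)
Definition is_interval (I : R -> Prop) : Prop :=
  forall x y z : R, I x -> I y -> x <= z <= y -> I z.

Definition strictly_concave_on (I : R -> Prop) (f : R -> R) : Prop :=
  forall x y l : R, I x -> I y -> x <> y -> 0 < l < 1 ->
    l * f x + (1 - l) * f y < f (l * x + (1 - l) * y).

(* Main.v *)
(* Write F(z) = (z - rho)^m g(z).  Near rho, F'/F = m/(z - rho) + q with q = g'/g
   holomorphic, and d^2/dt^2 Re G(sigma + it) = - Re G''(sigma + it) for holomorphic G.
   At rho + e with e real the polar part contributes - 2m/e^3, while Re q'' stays bounded
   near rho, so the sign is that of - e for small e <> 0.  A positive second derivative at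
   one point excludes strict concavity nearby.

   That q'' exists and is bounded rests on the fact that the derivative of a holomorphic
   function is holomorphic.  By Goursat's lemma, with a puncture at z,
   f(z) W(z) = A(z), where A and W are the integrals over a fixed square of
   f(zeta)/(zeta - z) and of 1/(zeta - z).  Both can be differentiated twice under the
   integral, and W does not vanish at the centre of the square, so f = A/W is twice
   differentiable there; the value 2 i pi of W is not needed. *)
Require Import Defs.
From Stdlib Require Import Reals Lra Classical_Prop IndefiniteDescription.
From Coquelicot Require Import Coquelicot.
Open Scope R_scope.

(** * Complex derivatives *)

Notation is_derive_C := (@is_derive C_AbsRing C_NormedModule).
Notation ex_derive_C := (@ex_derive C_AbsRing C_NormedModule).

(** The product uniform structure on [C] has squares as balls; [locally_C] trades them for the discs
    in which all estimates below are made. *)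
Lemma locally_Cmod (z : C) (P : C -> Prop) :
  locally (T := C_UniformSpace) z P <->
  exists r : R, 0 < r /\ forall w : C, Cmod (w - z) < r -> P w.
Proof.
rewrite locally_C; split.
- intros [r Hr]; exists r; split; [apply cond_pos | exact Hr].
- intros [r [r0 Hr]]; exists (mkposreal r r0); exact Hr.
Qed.

Lemma is_derive_C_eps (f : C -> C) (z l : C) :
  is_derive_C f z l <->
  forall eps : R, 0 < eps -> exists d : R, 0 < d /\ forall w : C,
    Cmod (w - z) < d -> Cmod (f w - f z - (w - z) * l) <= eps * Cmod (w - z).
Proof.
split.
- intros [_ H] eps eps0.
  destruct (H z (fun P HP => HP) (mkposreal eps eps0)) as [d Hd].
  exists d; split; [apply cond_pos | exact Hd].
- intros H; split; [apply (is_linear_scal_l (K := C_AbsRing) (V := C_NormedModule)) |].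
  intros y Hy eps.
  apply (is_filter_lim_locally_unique (V := AbsRing_NormedModule C_AbsRing)) in Hy; subst y.
  destruct (H eps (cond_pos eps)) as [d [d0 Hd]].
  exists (mkposreal d d0); exact Hd.
Qed.

Lemma is_derive_C_ext_loc (f g : C -> C) (z l : C) :
  locally (T := C_UniformSpace) z (fun w => f w = g w) ->
  is_derive_C f z l -> is_derive_C g z l.
Proof.
intros H; apply is_derive_ext_loc; exact (proj1 (locally_C _ _) H).
Qed.

Lemma is_derive_C_plus (f g : C -> C) (z lf lg : C) :
  is_derive_C f z lf -> is_derive_C g z lg ->
  is_derive_C (fun w => f w + g w)%C z (lf + lg)%C.
Proof. exact (is_derive_plus (K := C_AbsRing) (V := C_NormedModule) f g z lf lg). Qed.

(* [C_NormedModule] and [AbsRing_NormedModule C_AbsRing] have the same norm but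
   different balls. *)
Lemma is_derive_C_AbsRing (f : C -> C) (z l : C) :
  is_derive_C f z l <-> @is_derive C_AbsRing (AbsRing_NormedModule C_AbsRing) f z l.
Proof.
split; intros [_ H]; split.
- apply (is_linear_scal_l (K := C_AbsRing) (V := AbsRing_NormedModule C_AbsRing)).
- exact H.
- apply (is_linear_scal_l (K := C_AbsRing) (V := C_NormedModule)).
- exact H.
Qed.

Lemma is_derive_C_mult (f g : C -> C) (z lf lg : C) :
  is_derive_C f z lf -> is_derive_C g z lg ->
  is_derive_C (fun w => f w * g w)%C z (lf * g z + f z * lg)%C.
Proof.
rewrite !is_derive_C_AbsRing; intros Hf Hg.
exact (is_derive_mult (K := C_AbsRing) f g z lf lg Hf Hg Cmult_comm).
Qed.

Lemma is_derive_C_const (c z : C) : is_derive_C (fun _ => c) z (RtoC 0).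
Proof. exact (is_derive_const (K := C_AbsRing) (V := C_NormedModule) c z). Qed.

Lemma is_derive_C_id (z : C) : is_derive_C (fun w => w) z (RtoC 1).
Proof. apply is_derive_C_AbsRing; exact (is_derive_id (K := C_AbsRing) z). Qed.

Lemma is_derive_C_eq (f : C -> C) (z l l' : C) :
  is_derive_C f z l -> l = l' -> is_derive_C f z l'.
Proof. now intros H <-. Qed.

(** The first-order remainder of the inverse is exactly quadratic in [w - z], which is all that its
    differentiability requires. *)
Lemma Cinv_sub_expansion (z w : C) : z <> 0%C -> w <> 0%C ->
  (/ w - / z - (w - z) * - (/ z * / z) = (w - z) * (w - z) * (/ w * / z * / z))%C.
Proof. intros; field; auto. Qed.

Lemma is_derive_C_Cinv (z : C) : z <> 0%C -> is_derive_C Cinv z (- (/ z * / z))%C.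
Proof.
intros z0; apply is_derive_C_eps; intros eps eps0.
assert (m0 : 0 < Cmod z) by now apply Cmod_gt_0.
set (m := Cmod z) in *.
(* The radius [m / 2] keeps [Cmod w] above [m / 2], so the quadratic remainder has a coefficient of
   at most [2 / m ^ 3]; the second radius absorbs that into [eps]. *)
exists (Rmin (m / 2) (eps * (m * m * m) / 2)); split.
  apply Rmin_glb_lt; [lra |].
  assert (0 < eps * (m * m * m)) by (repeat apply Rmult_lt_0_compat; lra); lra.
intros w Hw.
assert (Hw1 : Cmod (w - z) < m / 2) by (eapply Rlt_le_trans; [exact Hw | apply Rmin_l]).
assert (Hw2 : Cmod (w - z) < eps * (m * m * m) / 2)
  by (eapply Rlt_le_trans; [exact Hw | apply Rmin_r]).
assert (Hmw : m / 2 < Cmod w).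
  assert (m <= Cmod w + Cmod (w - z)); [| lra].
  unfold m; replace z with (w + - (w - z))%C at 1 by ring.
  eapply Rle_trans; [apply Cmod_triangle |]; rewrite Cmod_opp; lra.
assert (w0 : w <> 0%C) by (apply Cmod_gt_0; lra).
rewrite Cinv_sub_expansion by auto.
rewrite !Cmod_mult, !Cmod_inv by auto; fold m.
set (e := Cmod (w - z)) in *.
assert (He : 0 <= e) by apply Cmod_ge_0.
replace (e * e * (/ Cmod w * / m * / m)) with ((e * (/ Cmod w * / m * / m)) * e) by ring.
apply Rmult_le_compat_r; auto.
apply Rle_trans with (eps * (m * m * m) / 2 * (/ (m / 2) * / m * / m)).
- apply Rmult_le_compat; try lra.
    repeat apply Rmult_le_pos; left; apply Rinv_0_lt_compat; lra.
  repeat apply Rmult_le_compat_r; try (left; apply Rinv_0_lt_compat; lra).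
  apply Rinv_le_contravar; lra.
- right; field; lra.
Qed.

Lemma is_derive_C_inv (f : C -> C) (z l : C) : f z <> 0%C ->
  is_derive_C f z l -> is_derive_C (fun w => / f w)%C z (- (l * (/ f z * / f z)))%C.
Proof.
intros f0 H.
eapply is_derive_C_eq.
- exact (is_derive_comp (K := C_AbsRing) (V := C_NormedModule) Cinv f z _ _
    (is_derive_C_Cinv _ f0) (proj1 (is_derive_C_AbsRing _ _ _) H)).
- change (l * - (/ f z * / f z) = - (l * (/ f z * / f z)))%C; ring.
Qed.

Lemma ex_derive_C_plus (f g : C -> C) (z : C) : ex_derive_C f z -> ex_derive_C g z ->
  ex_derive_C (fun w => f w + g w)%C z.
Proof. intros [l Hl] [k Hk]; eexists; exact (is_derive_C_plus _ _ _ _ _ Hl Hk). Qed.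

Lemma ex_derive_C_mult (f g : C -> C) (z : C) : ex_derive_C f z -> ex_derive_C g z ->
  ex_derive_C (fun w => f w * g w)%C z.
Proof. intros [l Hl] [k Hk]; eexists; exact (is_derive_C_mult _ _ _ _ _ Hl Hk). Qed.

Lemma ex_derive_C_inv (f : C -> C) (z : C) : f z <> 0%C -> ex_derive_C f z ->
  ex_derive_C (fun w => / f w)%C z.
Proof. intros f0 [l Hl]; eexists; exact (is_derive_C_inv _ _ _ f0 Hl). Qed.

Lemma ex_derive_C_const (c z : C) : ex_derive_C (fun _ => c) z.
Proof. eexists; apply is_derive_C_const. Qed.

Lemma ex_derive_C_id (z : C) : ex_derive_C (fun w => w) z.
Proof. eexists; apply is_derive_C_id. Qed.

Lemma ex_derive_C_ext (f g : C -> C) (z : C) : (forall w, f w = g w) ->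
  ex_derive_C f z -> ex_derive_C g z.
Proof. intros E [l Hl]; exists l; now apply is_derive_ext with (1 := E). Qed.

(** The definition of the derivative with [eps = 1] gives the Lipschitz constant [1 + Cmod l]. It
    bounds the difference quotient near [z] in Cauchy's formula. *)
Lemma ex_derive_C_locally_bounded (f : C -> C) (z : C) : ex_derive_C f z ->
  exists M r : R, 0 < r /\ forall w, Cmod (w - z) < r ->
    Cmod (f w - f z) <= M * Cmod (w - z).
Proof.
intros [l Hl].
destruct (proj1 (is_derive_C_eps _ _ _) Hl 1 Rlt_0_1) as [d [d0 Hd]].
exists (1 + Cmod l), d; split; auto.
intros w Hw.
replace (f w - f z)%C with ((f w - f z - (w - z) * l) + (w - z) * l)%C by ring.
eapply Rle_trans; [apply Cmod_triangle |].
specialize (Hd w Hw); rewrite Cmod_mult; lra.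
Qed.

Lemma ex_derive_C_continuous (f : C -> C) (z : C) (eps : R) :
  ex_derive_C f z -> 0 < eps ->
  locally (T := C_UniformSpace) z (fun w => Cmod (f w - f z) < eps).
Proof.
intros H eps0; destruct (ex_derive_C_locally_bounded f z H) as [M [r [r0 Hr]]].
apply locally_Cmod.
(* Nothing is known about the sign of [M]; [Rabs M + 1] is a positive bound for it. *)
assert (HM : 0 < Rabs M + 1) by (generalize (Rabs_pos M); lra).
exists (Rmin r (eps / (Rabs M + 1))); split.
  apply Rmin_glb_lt; auto; now apply Rdiv_lt_0_compat.
intros w Hw.
eapply Rle_lt_trans; [apply Hr; eapply Rlt_le_trans; [exact Hw | apply Rmin_l] |].
apply Rle_lt_trans with ((Rabs M + 1) * Cmod (w - z)).
  apply Rmult_le_compat_r; [apply Cmod_ge_0 | generalize (Rle_abs M); lra].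
assert (H2 : Cmod (w - z) < eps / (Rabs M + 1))
  by (eapply Rlt_le_trans; [exact Hw | apply Rmin_r]).
apply Rmult_lt_compat_l with (r := Rabs M + 1) in H2; auto.
replace ((Rabs M + 1) * (eps / (Rabs M + 1))) with eps in H2 by (field; lra); auto.
Qed.

Lemma ex_derive_C_nonzero (f : C -> C) (z : C) : ex_derive_C f z -> f z <> 0%C ->
  locally (T := C_UniformSpace) z (fun w => f w <> 0%C).
Proof.
intros H f0.
eapply filter_imp; [| exact (ex_derive_C_continuous f z _ H (proj1 (Cmod_gt_0 _) f0))].
cbv beta; intros w Hw E; rewrite E in Hw; replace (0 - f z)%C with (- f z)%C in Hw by ring.
rewrite Cmod_opp in Hw; lra.
Qed.

(** Chain rule along a real line in direction [v]. It passes from the scalar field [C] to the scalar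
    field [R], over which the integrals and the derivatives in [t] are taken. *)
Lemma is_derive_C_line (f : C -> C) (p v l : C) (t : R) :
  is_derive_C f (p + t * v)%C l ->
  @is_derive R_AbsRing C_R_NormedModule (fun s : R => f (p + s * v)%C) t (v * l)%C.
Proof.
intros H; split; [apply (is_linear_scal_l (K := R_AbsRing) (V := C_R_NormedModule)) |].
intros y Hy eps.
apply (is_filter_lim_locally_unique (V := AbsRing_NormedModule R_AbsRing)) in Hy; subst y.
assert (HM : 0 < Cmod v + 1) by (generalize (Cmod_ge_0 v); lra).
destruct (proj1 (is_derive_C_eps _ _ _) H (eps / (Cmod v + 1))) as [d [d0 Hd]].
  apply Rdiv_lt_0_compat; [apply cond_pos | auto].
assert (Hd0 : 0 < d / (Cmod v + 1)) by now apply Rdiv_lt_0_compat.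
exists (mkposreal _ Hd0); intros s Hs.
change (Rabs (s - t) < d / (Cmod v + 1)) in Hs.
assert (E : (p + s * v - (p + t * v) = RtoC (s - t) * v)%C) by (rewrite RtoC_minus; ring).
assert (Hst : Rabs (s - t) * Cmod v <= Rabs (s - t) * (Cmod v + 1))
  by (apply Rmult_le_compat_l; [apply Rabs_pos | lra]).
specialize (Hd (p + s * v)%C); rewrite E, Cmod_mult, Cmod_R in Hd.
assert (Hlt : Rabs (s - t) * Cmod v < d).
  eapply Rle_lt_trans; [exact Hst |].
  apply Rmult_lt_compat_r with (r := Cmod v + 1) in Hs; auto.
  replace (d / (Cmod v + 1) * (Cmod v + 1)) with d in Hs by (field; lra); auto.
specialize (Hd Hlt).
rewrite <- Cmod_norm.
change (Cmod (f (p + s * v)%C - f (p + t * v)%C - scal (V := C_R_NormedModule) (s - t)%R ((v * l)%C : C_R_NormedModule))%C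
  <= eps * Rabs (s - t)).
replace (scal (V := C_R_NormedModule) (s - t)%R ((v * l)%C : C_R_NormedModule)) with
  (RtoC (s - t) * v * l)%C.
- eapply Rle_trans; [exact Hd |].
  apply Rle_trans with (eps / (Cmod v + 1) * (Rabs (s - t) * (Cmod v + 1))).
    apply Rmult_le_compat_l; auto; left; apply Rdiv_lt_0_compat; [apply cond_pos | auto].
  right; field; lra.
- rewrite scal_R_Cmult; ring.
Qed.

(** * Integrals over the boundary of a rectangle *)

(** Only the four sides are constrained, so an integrand may be singular inside the rectangle. *)
Definition frame (a b c d : R) (P : C -> Prop) : Prop :=
  (forall x : R, a <= x <= b -> P (x, c) /\ P (x, d)) /\
  (forall y : R, c <= y <= d -> P (a, y) /\ P (b, y)).

Notation RIntC := (@RInt C_R_CompleteNormedModule).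
Notation is_RIntC := (@is_RInt C_R_NormedModule).
Notation ex_RIntC := (@ex_RInt C_R_NormedModule).

(** The counterclockwise contour integral: dz is dx on the horizontal sides and i dy on the vertical
    ones. *)
Definition rect_int (f : C -> C) (a b c d : R) : C :=
  (RIntC (fun x => f (x, c)) a b - RIntC (fun x => f (x, d)) a b
   + Ci * (RIntC (fun y => f (b, y)) c d - RIntC (fun y => f (a, y)) c d))%C.

Lemma frame_imp (a b c d : R) (P Q : C -> Prop) :
  (forall z, P z -> Q z) -> frame a b c d P -> frame a b c d Q.
Proof.
intros PQ [H1 H2]; split; intros t Ht; [destruct (H1 t Ht) | destruct (H2 t Ht)]; auto.
Qed.

Lemma frame_and (a b c d : R) (P Q : C -> Prop) :
  frame a b c d P -> frame a b c d Q -> frame a b c d (fun z => P z /\ Q z).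
Proof.
intros [H1 H2] [H3 H4]; split; intros t Ht;
  [destruct (H1 t Ht), (H3 t Ht) | destruct (H2 t Ht), (H4 t Ht)]; auto.
Qed.

Lemma frame_of_rect (a b c d : R) (P : C -> Prop) : a <= b -> c <= d ->
  (forall x y, a <= x <= b -> c <= y <= d -> P (x, y)) -> frame a b c d P.
Proof. intros ab cd H; split; intros t Ht; split; apply H; lra. Qed.

Lemma is_derive_C_horizontal (f : C -> C) (x y : R) (l : C) :
  is_derive_C f (x, y) l ->
  @is_derive R_AbsRing C_R_NormedModule (fun s : R => f (s, y)) x l.
Proof.
assert (E : forall s : R, ((0, y) + s * 1)%C = (s, y))
  by (intros s; apply injective_projections; simpl; ring).
intros H; rewrite <- (E x) in H; apply is_derive_C_line in H.
rewrite Cmult_1_l in H.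
apply is_derive_ext with (2 := H); intros s; now rewrite E.
Qed.

Lemma is_derive_C_vertical (f : C -> C) (x y : R) (l : C) :
  is_derive_C f (x, y) l ->
  @is_derive R_AbsRing C_R_NormedModule (fun s : R => f (x, s)) y (Ci * l)%C.
Proof.
assert (E : forall s : R, ((x, 0) + s * Ci)%C = (x, s))
  by (intros s; apply injective_projections; simpl; ring).
intros H; rewrite <- (E y) in H; apply is_derive_C_line in H.
apply is_derive_ext with (2 := H); intros s; now rewrite E.
Qed.

Lemma ex_RIntC_ex_derive (g : R -> C) (a b : R) : a <= b ->
  (forall t, a <= t <= b -> @ex_derive R_AbsRing C_R_NormedModule g t) -> ex_RIntC g a b.
Proof.
intros ab H; apply (ex_RInt_continuous (V := C_R_CompleteNormedModule)).
rewrite Rmin_left, Rmax_right by auto.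
intros t Ht; apply (ex_derive_continuous (V := C_R_NormedModule)); auto.
Qed.

Lemma frame_ex_RInt (f : C -> C) (a b c d : R) : a <= b -> c <= d ->
  frame a b c d (ex_derive_C f) ->
  (ex_RIntC (fun x => f (x, c)) a b /\ ex_RIntC (fun x => f (x, d)) a b) /\
  (ex_RIntC (fun y => f (a, y)) c d /\ ex_RIntC (fun y => f (b, y)) c d).
Proof.
intros ab cd [H1 H2].
split; split; apply ex_RIntC_ex_derive; auto; intros t Ht;
  [destruct (H1 t Ht) as [[l Hl] _] | destruct (H1 t Ht) as [_ [l Hl]] |
   destruct (H2 t Ht) as [[l Hl] _] | destruct (H2 t Ht) as [_ [l Hl]]];
  first [exists l; exact (is_derive_C_horizontal _ _ _ _ Hl)
        | exists (Ci * l)%C; exact (is_derive_C_vertical _ _ _ _ Hl)].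
Qed.

Lemma RIntC_plus (f g : R -> C) (a b : R) : ex_RIntC f a b -> ex_RIntC g a b ->
  RIntC (fun t => f t + g t)%C a b = (RIntC f a b + RIntC g a b)%C.
Proof. exact (RInt_plus (V := C_R_CompleteNormedModule) f g a b). Qed.

Lemma RIntC_Chasles (f : R -> C) (a b c : R) : ex_RIntC f a b -> ex_RIntC f b c ->
  RIntC f a c = (RIntC f a b + RIntC f b c)%C.
Proof.
intros H1 H2; symmetry; exact (RInt_Chasles (V := C_R_CompleteNormedModule) f a b c H1 H2).
Qed.

(** The integral is taken over the real module [C_R_NormedModule], so a complex factor has to be
    pulled out through real and imaginary parts. *)
Lemma is_RIntC_Cmult (f : R -> C) (a b : R) (k l : C) : is_RIntC f a b l ->
  is_RIntC (fun t => k * f t)%C a b (k * l)%C.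
Proof.
intros H.
assert (H1 := is_RInt_fct_extend_fst (U := R_NormedModule) (V := R_NormedModule) _ _ _ _ H).
assert (H2 := is_RInt_fct_extend_snd (U := R_NormedModule) (V := R_NormedModule) _ _ _ _ H).
apply (is_RInt_fct_extend_pair (U := R_NormedModule) (V := R_NormedModule)).
- exact (is_RInt_minus _ _ _ _ _ _ (is_RInt_scal _ _ _ (fst k) _ H1)
    (is_RInt_scal _ _ _ (snd k) _ H2)).
- exact (is_RInt_plus _ _ _ _ _ _ (is_RInt_scal _ _ _ (fst k) _ H2)
    (is_RInt_scal _ _ _ (snd k) _ H1)).
Qed.

Lemma RIntC_Cmult (f : R -> C) (a b : R) (k : C) : ex_RIntC f a b ->
  RIntC (fun t => k * f t)%C a b = (k * RIntC f a b)%C.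
Proof.
intros H; apply (is_RInt_unique (V := C_R_CompleteNormedModule)).
apply is_RIntC_Cmult; exact (RInt_correct (V := C_R_CompleteNormedModule) f a b H).
Qed.

Lemma Cmod_RIntC_le (f : R -> C) (a b M : R) : a <= b -> ex_RIntC f a b ->
  (forall t, a <= t <= b -> Cmod (f t) <= M) -> Cmod (RIntC f a b) <= (b - a) * M.
Proof.
intros ab Hf H; rewrite Cmod_norm.
apply (norm_RInt_le_const (V := C_R_NormedModule) f a b); auto.
- intros t Ht; rewrite <- Cmod_norm; auto.
- exact (RInt_correct (V := C_R_CompleteNormedModule) f a b Hf).
Qed.

Lemma rect_int_plus (f g : C -> C) (a b c d : R) : a <= b -> c <= d ->
  frame a b c d (ex_derive_C f) -> frame a b c d (ex_derive_C g) ->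
  rect_int (fun z => f z + g z)%C a b c d = (rect_int f a b c d + rect_int g a b c d)%C.
Proof.
intros ab cd Hf Hg.
destruct (frame_ex_RInt f a b c d ab cd Hf) as [[? ?] [? ?]].
destruct (frame_ex_RInt g a b c d ab cd Hg) as [[? ?] [? ?]].
unfold rect_int; rewrite !RIntC_plus by auto; ring.
Qed.

Lemma rect_int_scal (k : C) (f : C -> C) (a b c d : R) : a <= b -> c <= d ->
  frame a b c d (ex_derive_C f) ->
  rect_int (fun z => k * f z)%C a b c d = (k * rect_int f a b c d)%C.
Proof.
intros ab cd Hf.
destruct (frame_ex_RInt f a b c d ab cd Hf) as [[? ?] [? ?]].
unfold rect_int; rewrite !RIntC_Cmult by auto; ring.
Qed.

Lemma rect_int_ext (f g : C -> C) (a b c d : R) : a <= b -> c <= d ->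
  frame a b c d (fun z => f z = g z) -> rect_int f a b c d = rect_int g a b c d.
Proof.
intros ab cd [H1 H2]; unfold rect_int.
f_equal; [f_equal | do 2 f_equal]; apply (RInt_ext (V := C_R_CompleteNormedModule));
  rewrite Rmin_left, Rmax_right by auto; intros t Ht; try apply H1; try apply H2; lra.
Qed.

(** The usual estimate: perimeter times a bound for the integrand. *)
Lemma Cmod_rect_int_le (f : C -> C) (a b c d M : R) : a <= b -> c <= d ->
  frame a b c d (ex_derive_C f) -> frame a b c d (fun z => Cmod (f z) <= M) ->
  Cmod (rect_int f a b c d) <= 2 * ((b - a) + (d - c)) * M.
Proof.
intros ab cd Hf [H1 H2].
destruct (frame_ex_RInt f a b c d ab cd Hf) as [[? ?] [? ?]].
unfold rect_int, Cminus.
eapply Rle_trans; [apply Cmod_triangle |].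
rewrite Cmod_mult, Cmod_Ci.
assert (T : forall u v p q, Cmod u <= p -> Cmod v <= q -> Cmod (u + - v) <= p + q).
  intros u v p q Hu Hv; eapply Rle_trans; [apply Cmod_triangle |].
  rewrite Cmod_opp; lra.
apply Rle_trans with (((b - a) * M + (b - a) * M) + 1 * ((d - c) * M + (d - c) * M));
  [| lra].
apply Rplus_le_compat; [| apply Rmult_le_compat_l; [lra |]]; apply T;
  apply Cmod_RIntC_le; auto; intros t Ht; try apply H1; try apply H2; auto.
Qed.

Lemma rect_int_split_x (f : C -> C) (a e b c d : R) : a <= e <= b -> c <= d ->
  frame a e c d (ex_derive_C f) -> frame e b c d (ex_derive_C f) ->
  rect_int f a b c d = (rect_int f a e c d + rect_int f e b c d)%C.
Proof.
intros [ae eb] cd H1 H2.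
destruct (frame_ex_RInt f a e c d ae cd H1) as [[? ?] [? ?]].
destruct (frame_ex_RInt f e b c d eb cd H2) as [[? ?] [? ?]].
unfold rect_int; rewrite !(RIntC_Chasles _ a e b) by auto; ring.
Qed.

Lemma rect_int_split_y (f : C -> C) (a b c e d : R) : a <= b -> c <= e <= d ->
  frame a b c e (ex_derive_C f) -> frame a b e d (ex_derive_C f) ->
  rect_int f a b c d = (rect_int f a b c e + rect_int f a b e d)%C.
Proof.
intros ab [ce ed] H1 H2.
destruct (frame_ex_RInt f a b c e ab ce H1) as [[? ?] [? ?]].
destruct (frame_ex_RInt f a b e d ab ed H2) as [[? ?] [? ?]].
unfold rect_int; rewrite !(RIntC_Chasles _ c e d) by auto; ring.
Qed.

(** The fundamental theorem of calculus on each side leaves differences of [G] at the corners, which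
    cancel around the contour. Differentiability of [f] supplies the continuity of the integrand. *)
Lemma rect_int_primitive (G f : C -> C) (a b c d : R) : a <= b -> c <= d ->
  frame a b c d (ex_derive_C f) -> frame a b c d (fun z => is_derive_C G z (f z)) ->
  rect_int f a b c d = 0%C.
Proof.
intros ab cd Hf HG.
destruct (frame_ex_RInt f a b c d ab cd Hf) as [[R1 R2] [R3 R4]].
assert (Hh : forall y, (forall x, a <= x <= b -> is_derive_C G (x, y) (f (x, y))
    /\ ex_derive_C f (x, y)) ->
  RIntC (fun x => f (x, y)) a b = (G (b, y) - G (a, y))%C).
  intros y Hy; apply (is_RInt_unique (V := C_R_CompleteNormedModule)).
  apply (is_RInt_derive (V := C_R_CompleteNormedModule) (fun x => G (x, y)));
    rewrite Rmin_left, Rmax_right by auto; intros x Hx; destruct (Hy x Hx) as [D [l Hl]].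
  - now apply is_derive_C_horizontal.
  - apply (ex_derive_continuous (V := C_R_NormedModule)).
    exists l; now apply is_derive_C_horizontal.
assert (Hv : forall x, (forall y, c <= y <= d -> is_derive_C G (x, y) (f (x, y))
    /\ ex_derive_C f (x, y)) ->
  ex_RIntC (fun y => f (x, y)) c d ->
  (Ci * RIntC (fun y => f (x, y)) c d)%C = (G (x, d) - G (x, c))%C).
  intros x Hx HR; rewrite <- RIntC_Cmult by auto.
  apply (is_RInt_unique (V := C_R_CompleteNormedModule)).
  apply (is_RInt_derive (V := C_R_CompleteNormedModule) (fun y => G (x, y)));
    rewrite Rmin_left, Rmax_right by auto; intros y Hy; destruct (Hx y Hy) as [D [l Hl]].
  - now apply is_derive_C_vertical.
  - apply (ex_derive_continuous (V := C_R_NormedModule)).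
    exists (Ci * (Ci * l))%C; apply (is_derive_C_vertical (fun z => Ci * f z)%C).
    eapply is_derive_C_eq; [exact (is_derive_C_mult _ _ _ _ _ (is_derive_C_const Ci _) Hl) |].
    change (RtoC 0 * f (x, y) + Ci * l = Ci * l)%C; ring.
destruct (frame_and _ _ _ _ _ _ HG Hf) as [K1 K2].
unfold rect_int.
rewrite !Hh by (intros x Hx; apply K1; auto).
replace (Ci * (RIntC (fun y => f (b, y)) c d - RIntC (fun y => f (a, y)) c d))%C with
  (Ci * RIntC (fun y => f (b, y)) c d - Ci * RIntC (fun y => f (a, y)) c d)%C by ring.
rewrite !Hv by (auto; intros y Hy; apply K2; auto).
ring.
Qed.

(** * Goursat's lemma *)

(** Every left end lies below every right end, so the supremum of the left ends belongs to all
    segments. *)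
Lemma nested_segments (u v : nat -> R) :
  (forall n, u n <= u (S n)) -> (forall n, v (S n) <= v n) -> (forall n, u n <= v n) ->
  exists x, forall n, u n <= x <= v n.
Proof.
intros Hu Hv Huv.
assert (Mu : forall n k, u n <= u (n + k)%nat).
  intros n k; induction k as [|k IH]; [rewrite Nat.add_0_r; lra |].
  rewrite Nat.add_succ_r; specialize (Hu (n + k)%nat); lra.
assert (Mv : forall n k, v (n + k)%nat <= v n).
  intros n k; induction k as [|k IH]; [rewrite Nat.add_0_r; lra |].
  rewrite Nat.add_succ_r; specialize (Hv (n + k)%nat); lra.
assert (Muv : forall n m, u n <= v m).
  intros n m; specialize (Mu n m); specialize (Mv m n); specialize (Huv (n + m)%nat).
  rewrite Nat.add_comm in Mv; lra.
destruct (completeness (fun x => exists n, x = u n)) as [x [ub lub]].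
- exists (v 0%nat); intros y [n ->]; apply Muv.
- exists (u 0%nat), 0%nat; reflexivity.
- exists x; intros n; split; [apply ub; now exists n |].
  apply lub; intros y [m ->]; apply Muv.
Qed.

Lemma pow2_half (w : R) (n : nat) : w / 2 ^ n = w / 2 ^ S n + w / 2 ^ S n.
Proof. simpl; field; apply pow_nonzero; lra. Qed.

Lemma div_pow2_pos (w : R) (n : nat) : 0 <= w -> 0 <= w / 2 ^ n.
Proof.
intros Hw; apply Rmult_le_pos; auto; left; apply Rinv_0_lt_compat, pow_lt; lra.
Qed.

(** [B n a c] is an invariant of the stage [n] rectangle with lower left corner [(a, c)]. Dependent
    choice produces a sequence of quadrants, and completeness a common point. *)
Lemma nested_rectangles (w h a c : R) (B : nat -> R -> R -> Prop) :
  0 <= w -> 0 <= h -> B 0%nat a c ->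
  (forall n a c, B n a c -> exists a' c',
    (a' = a \/ a' = a + w / 2 ^ S n) /\ (c' = c \/ c' = c + h / 2 ^ S n) /\ B (S n) a' c') ->
  exists x y, forall n, exists a c,
    B n a c /\ a <= x <= a + w / 2 ^ n /\ c <= y <= c + h / 2 ^ n.
Proof.
intros w0 h0 B0 step.
(* The step is made total, with an arbitrary value where the invariant fails, so that a choice
   function can be iterated before the invariant is proved along the sequence. *)
assert (S' : forall n (p : R * R), exists q : R * R, B n (fst p) (snd p) ->
  (fst q = fst p \/ fst q = fst p + w / 2 ^ S n) /\
  (snd q = snd p \/ snd q = snd p + h / 2 ^ S n) /\ B (S n) (fst q) (snd q)).
  intros n p; destruct (classic (B n (fst p) (snd p))) as [Hp | Hp].
  - destruct (step _ _ _ Hp) as [a' [c' H]]; now exists (a', c').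
  - exists p; intros Hp'; now elim Hp.
pose (next n p := proj1_sig (constructive_indefinite_description _ (S' n p))).
pose (s := nat_rect (fun _ => (R * R)%type) (a, c) next).
assert (Hs : forall n, B n (fst (s n)) (snd (s n))).
  induction n as [|n IH]; [exact B0 |].
  exact (proj2 (proj2 (proj2_sig (constructive_indefinite_description _ (S' n (s n))) IH))).
assert (Hn : forall n, (fst (s (S n)) = fst (s n) \/ fst (s (S n)) = fst (s n) + w / 2 ^ S n) /\
  (snd (s (S n)) = snd (s n) \/ snd (s (S n)) = snd (s n) + h / 2 ^ S n)).
  intros n.
  destruct (proj2_sig (constructive_indefinite_description _ (S' n (s n))) (Hs n))
    as [H1 [H2 _]]; split; assumption.
assert (W : forall n, 0 <= w / 2 ^ n) by (intros; now apply div_pow2_pos).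
assert (H : forall n, 0 <= h / 2 ^ n) by (intros; now apply div_pow2_pos).
destruct (nested_segments (fun n => fst (s n)) (fun n => fst (s n) + w / 2 ^ n)) as [x Hx];
  try (intros n; generalize (pow2_half w n) (Hn n) (W n) (W (S n)); lra).
destruct (nested_segments (fun n => snd (s n)) (fun n => snd (s n) + h / 2 ^ n)) as [y Hy];
  try (intros n; generalize (pow2_half h n) (Hn n) (H n) (H (S n)); lra).
exists x, y; intros n; exists (fst (s n)), (snd (s n)); repeat split; auto;
  try apply Hx; try apply Hy.
Qed.

(** The integral is the sum over the four quadrants, because inner sides cancel; by the triangle
    inequality one quadrant carries at least a quarter of the modulus. *)
Lemma rect_int_quadrant (f : C -> C) (a c w h : R) : 0 <= w -> 0 <= h ->
  (forall x y, a <= x <= a + (w + w) -> c <= y <= c + (h + h) -> ex_derive_C f (x, y)) ->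
  exists a' c', (a' = a \/ a' = a + w) /\ (c' = c \/ c' = c + h) /\
    Cmod (rect_int f a (a + (w + w)) c (c + (h + h)))
      <= 4 * Cmod (rect_int f a' (a' + w) c' (c' + h)).
Proof.
intros w0 h0 Hf.
assert (E : rect_int f a (a + (w + w)) c (c + (h + h)) =
  (rect_int f a (a + w) c (c + h) + rect_int f a (a + w) (c + h) (c + h + h) +
   (rect_int f (a + w) (a + w + w) c (c + h) +
    rect_int f (a + w) (a + w + w) (c + h) (c + h + h)))%C).
  replace (a + (w + w)) with (a + w + w) by ring.
  replace (c + (h + h)) with (c + h + h) by ring.
  rewrite (rect_int_split_x f a (a + w)), (rect_int_split_y f a (a + w) c (c + h)),
    (rect_int_split_y f (a + w) (a + w + w) c (c + h)); try lra; try reflexivity; apply frame_of_rect; try lra; intros x y Hx Hy; apply Hf; lra.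
set (J := Cmod (rect_int f a (a + (w + w)) c (c + (h + h)))).
assert (HJ : J <= Cmod (rect_int f a (a + w) c (c + h)) +
  Cmod (rect_int f a (a + w) (c + h) (c + h + h)) +
   (Cmod (rect_int f (a + w) (a + w + w) c (c + h)) +
    Cmod (rect_int f (a + w) (a + w + w) (c + h) (c + h + h)))).
  unfold J; rewrite E.
  eapply Rle_trans; [apply Cmod_triangle |].
  apply Rplus_le_compat; apply Cmod_triangle.
destruct (Rle_dec J (4 * Cmod (rect_int f a (a + w) c (c + h)))) as [H1 | H1].
  exists a, c; auto.
destruct (Rle_dec J (4 * Cmod (rect_int f a (a + w) (c + h) (c + h + h)))) as [H2 | H2].
  exists a, (c + h); auto.
destruct (Rle_dec J (4 * Cmod (rect_int f (a + w) (a + w + w) c (c + h)))) as [H3 | H3].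
  exists (a + w), c; auto.
(* The other three quadrants each carry less than a quarter, so [HJ] leaves more than a quarter for
   this one. *)
exists (a + w), (c + h); repeat split; auto; lra.
Qed.

Lemma Cmod_pair_le (x y u v r s : R) : Rabs (x - u) <= r -> Rabs (y - v) <= s ->
  Cmod ((x, y) - (u, v))%C <= r + s.
Proof.
intros Hr Hs.
replace ((x, y) - (u, v))%C with (RtoC (x - u) + Ci * RtoC (y - v))%C
  by (apply injective_projections; simpl; ring).
eapply Rle_trans; [apply Cmod_triangle |].
rewrite Cmod_mult, Cmod_Ci, !Cmod_R; lra.
Qed.

Lemma rect_int_affine (p q : C) (a b c d : R) : a <= b -> c <= d ->
  rect_int (fun z => p + q * z)%C a b c d = 0%C.
Proof.
intros ab cd.
apply (rect_int_primitive (fun z => p * z + q * / 2 * (z * z))%C); auto;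
  apply frame_of_rect; auto; intros x y _ _.
- apply ex_derive_C_plus; [apply ex_derive_C_const |].
  apply ex_derive_C_mult; [apply ex_derive_C_const | apply ex_derive_C_id].
- eapply is_derive_C_eq.
  + apply is_derive_C_plus; apply is_derive_C_mult;
      [apply is_derive_C_const | apply is_derive_C_id | apply is_derive_C_const |
       apply is_derive_C_mult; apply is_derive_C_id].
  + generalize ((x, y) : C); intros z; cbv beta.
    change (0 * z + p * 1 + (0 * (z * z) + q * / 2 * (1 * z + z * 1)) = p + q * z)%C.
    field; intros E; apply RtoC_inj in E; lra.
Qed.

(** Subtracting the tangent affine function at [z] does not change the integral. What remains is at
    most [eps / 2 * (w + h)] on the frame, whose perimeter is [2 * (w + h)]. *)
Lemma goursat_local (f : C -> C) (z : C) (eps : R) : 0 < eps -> ex_derive_C f z ->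
  exists r, 0 < r /\ forall a c w h, 0 <= w -> 0 <= h -> w + h < r ->
    a <= fst z <= a + w -> c <= snd z <= c + h ->
    frame a (a + w) c (c + h) (ex_derive_C f) ->
    Cmod (rect_int f a (a + w) c (c + h)) <= eps * (w + h) ^ 2.
Proof.
intros eps0 [l Hl].
destruct (proj1 (is_derive_C_eps _ _ _) Hl (eps / 2)) as [r [r0 Hr]]; [lra |].
exists r; split; auto; intros a c w h w0 h0 wh Hx Hy Hf.
(* This is [f u - f z - (u - z) * l], grouped so that [rect_int_affine] applies to the part
   subtracted from [f]. *)
pose (err := fun u : C => (f u + ((- f z + z * l) + (- l) * u))%C).
assert (Hk : forall p q u : C, ex_derive_C (fun u : C => p + q * u)%C u).
  intros p q u; apply ex_derive_C_plus; [apply ex_derive_C_const |].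
  apply ex_derive_C_mult; [apply ex_derive_C_const | apply ex_derive_C_id].
assert (Herr : frame a (a + w) c (c + h) (ex_derive_C err)).
  apply frame_imp with (2 := Hf); intros u Hu; apply ex_derive_C_plus; auto.
assert (E : rect_int f a (a + w) c (c + h) = rect_int err a (a + w) c (c + h)).
  unfold err; rewrite rect_int_plus, rect_int_affine; try lra; auto.
    now rewrite Cplus_0_r.
  apply frame_of_rect; try lra; auto.
rewrite E.
eapply Rle_trans; [apply Cmod_rect_int_le with (M := eps / 2 * (w + h)); try lra; auto |].
- apply frame_of_rect; try lra; intros x y Hx' Hy'.
  assert (Hd : Cmod ((x, y) - z) <= w + h).
    destruct z as [u v]; simpl in *.
    apply Cmod_pair_le; apply Rabs_le; lra.
  replace (err (x, y)) with (f (x, y) - f z - ((x, y) - z) * l)%C by (unfold err; ring).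
  eapply Rle_trans; [apply Hr; lra |].
  apply Rmult_le_compat_l; lra.
- right; simpl; field.
Qed.

(** Repeated quartering loses a factor [4 ^ n], which the bound of [goursat_local] at the common
    point recovers, since it is quadratic in the size of the rectangle. Hence the integral is below
    every multiple of [(w + h) ^ 2]. *)
Lemma goursat (f : C -> C) (a b c d : R) : a <= b -> c <= d ->
  (forall x y, a <= x <= b -> c <= y <= d -> ex_derive_C f (x, y)) ->
  rect_int f a b c d = 0%C.
Proof.
intros ab cd Hf.
set (w := b - a); set (h := d - c).
assert (w0 : 0 <= w) by (unfold w; lra).
assert (h0 : 0 <= h) by (unfold h; lra).
set (K := Cmod (rect_int f a b c d)).
pose (B (n : nat) (a' c' : R) := a <= a' /\ a' + w / 2 ^ n <= b /\
  c <= c' /\ c' + h / 2 ^ n <= d /\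
  K <= 4 ^ n * Cmod (rect_int f a' (a' + w / 2 ^ n) c' (c' + h / 2 ^ n))).
destruct (nested_rectangles w h a c B) as [x [y Hxy]]; auto.
- unfold B; simpl; rewrite !Rdiv_1_r; unfold w, h.
  replace (a + (b - a)) with b by ring; replace (c + (d - c)) with d by ring.
  unfold K; repeat split; lra.
- intros n a' c' (H1 & H2 & H3 & H4 & H5).
  rewrite (pow2_half w), (pow2_half h) in H5; rewrite (pow2_half w) in H2.
  rewrite (pow2_half h) in H4.
  assert (W := div_pow2_pos w (S n) w0); assert (H := div_pow2_pos h (S n) h0).
  destruct (rect_int_quadrant f a' c' (w / 2 ^ S n) (h / 2 ^ S n)) as
    [a2 [c2 [Ha [Hc HJ]]]]; auto.
    intros s t Hs Ht; apply Hf; lra.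
  exists a2, c2; split; [| split]; auto.
  unfold B; repeat split; try lra.
  eapply Rle_trans; [exact H5 |].
  apply Rmult_le_compat_l with (r := 4 ^ n) in HJ; [| apply pow_le; lra].
  eapply Rle_trans; [exact HJ |]; right; simpl; ring.
- assert (HK : forall eps, 0 < eps -> K <= eps * (w + h) ^ 2).
    intros eps eps0.
    assert (Hz : ex_derive_C f (x, y)).
      destruct (Hxy 0%nat) as [a' [c' [(H1 & H2 & H3 & H4 & _) [Hx Hy]]]]; apply Hf; lra.
    destruct (goursat_local f (x, y) eps eps0 Hz) as [r [r0 Hr]].
    (* [n] is large enough that the stage [n] rectangle fits the radius [r]; the [+ 1] keeps the
       divisor positive when the rectangle degenerates to a point. *)
    destruct (pow_lt_1_zero (/ 2)) with (y := r / (w + h + 1)) as [n Hn].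
      rewrite Rabs_right; lra.
      apply Rdiv_lt_0_compat; lra.
    specialize (Hn n (le_n n)).
    rewrite Rabs_right in Hn by (apply Rle_ge, pow_le; lra).
    assert (P2 : 0 < 2 ^ n) by (apply pow_lt; lra).
    rewrite pow_inv in Hn.
    destruct (Hxy n) as [a' [c' [(H1 & H2 & H3 & H4 & H5) [Hx Hy]]]].
    assert (W := div_pow2_pos w n w0); assert (H := div_pow2_pos h n h0).
    eapply Rle_trans; [exact H5 |].
    apply Rle_trans with (4 ^ n * (eps * (w / 2 ^ n + h / 2 ^ n) ^ 2)).
    + apply Rmult_le_compat_l; [apply pow_le; lra |].
      apply Hr; auto.
      * replace (w / 2 ^ n + h / 2 ^ n) with ((w + h) * / 2 ^ n) by (field; lra).
        apply Rle_lt_trans with ((w + h + 1) * / 2 ^ n).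
          apply Rmult_le_compat_r; [left; now apply Rinv_0_lt_compat | lra].
        apply Rmult_lt_compat_l with (r := w + h + 1) in Hn; [| lra].
        replace ((w + h + 1) * (r / (w + h + 1))) with r in Hn by (field; lra); auto.
      * apply frame_of_rect; try lra; intros s t Hs Ht; apply Hf; lra.
    + right; replace 4 with (2 * 2) by ring; rewrite Rpow_mult_distr; field; lra.
  apply Cmod_eq_0; fold K.
  assert (K0 : 0 <= K) by apply Cmod_ge_0.
  destruct (Rle_lt_or_eq_dec _ _ K0) as [Kp | Kp]; auto.
  assert (D0 : 0 <= (w + h) ^ 2) by apply pow2_ge_0.
  (* This [eps] would give [K <= K / 2], impossible for [K > 0]. *)
  assert (e0 : 0 < K / (2 * ((w + h) ^ 2 + 1))) by (apply Rdiv_lt_0_compat; lra).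
  specialize (HK _ e0).
  assert (K / (2 * ((w + h) ^ 2 + 1)) * (w + h) ^ 2 <= K / 2); [| lra].
  apply Rle_trans with (K / (2 * ((w + h) ^ 2 + 1)) * ((w + h) ^ 2 + 1)).
    apply Rmult_le_compat_l; lra.
  right; field; lra.
Qed.

Lemma goursat_punctured (f : C -> C) (x0 y0 a b c d M r : R) : 0 < r ->
  a < x0 < b -> c < y0 < d ->
  (forall x y, a <= x <= b -> c <= y <= d -> (x, y) <> (x0, y0) -> ex_derive_C f (x, y)) ->
  (forall z, z <> (x0, y0) -> Cmod (z - (x0, y0)) < r -> Cmod (f z) <= M) ->
  rect_int f a b c d = 0%C.
Proof.
intros r0 Hx Hy Hf HM.
(* Only the square of half-side [e] around the puncture contributes, and its integral
   is O(e). *)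
assert (Hsm : forall e, 0 < e < r / 4 -> e < x0 - a -> e < b - x0 -> e < y0 - c -> e < d - y0 ->
  Cmod (rect_int f a b c d) <= e * (8 * M)).
  intros e He H1 H2 H3 H4.
  assert (Df : forall a' b' c' d', a <= a' <= b' -> b' <= b -> c <= c' <= d' -> d' <= d ->
     (b' < x0 \/ x0 < a') \/ (d' < y0 \/ y0 < c') ->
     forall x y, a' <= x <= b' -> c' <= y <= d' -> ex_derive_C f (x, y)).
    intros a' b' c' d' Ha Hb Hc Hd Ho x y Hx' Hy'; apply Hf; try lra.
    intros E; injection E; intros; lra.
  assert (Fr : forall a' b' c' d', a <= a' <= b' -> b' <= b -> c <= c' <= d' -> d' <= d ->
     a' <> x0 -> b' <> x0 -> c' <> y0 -> d' <> y0 -> frame a' b' c' d' (ex_derive_C f)).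
    intros a' b' c' d' Ha Hb Hc Hd N1 N2 N3 N4; split; intros t Ht; split; apply Hf; try lra;
      intros E; injection E; intros; lra.
  (* Cut off the strips to the left and right, then the pieces below and above; [goursat]
     annihilates these four and the central square is left. *)
  rewrite (rect_int_split_x f a (x0 - e) b c d); try lra; try (apply Fr; lra).
  rewrite (rect_int_split_x f (x0 - e) (x0 + e) b c d); try lra; try (apply Fr; lra).
  rewrite (rect_int_split_y f (x0 - e) (x0 + e) c (y0 - e) d); try lra; try (apply Fr; lra).
  rewrite (rect_int_split_y f (x0 - e) (x0 + e) (y0 - e) (y0 + e) d); try lra;
    try (apply Fr; lra).
  rewrite (goursat f a (x0 - e) c d), (goursat f (x0 + e) b c d),
    (goursat f (x0 - e) (x0 + e) c (y0 - e)), (goursat f (x0 - e) (x0 + e) (y0 + e) d);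
    try lra; try (apply Df; lra).
  rewrite !Cplus_0_l, !Cplus_0_r.
  eapply Rle_trans; [apply Cmod_rect_int_le with (M := M); try lra; [apply Fr; lra |] |].
  - assert (B : forall x y, (x, y) <> (x0, y0) -> x0 - e <= x <= x0 + e ->
      y0 - e <= y <= y0 + e -> Cmod (f (x, y)) <= M).
      intros x y N Hx' Hy'; apply HM; auto.
      apply Rle_lt_trans with (e + e); [| lra].
      apply Cmod_pair_le; apply Rabs_le; lra.
    split; intros t Ht; split; apply B; try lra; intros E; injection E; intros; lra.
  - right; ring.
set (m := Rmin (r / 4) (Rmin (Rmin (x0 - a) (b - x0)) (Rmin (y0 - c) (d - y0)))).
assert (m0 : 0 < m) by (unfold m; repeat apply Rmin_glb_lt; lra).
assert (Hm : m <= r / 4 /\ m <= x0 - a /\ m <= b - x0 /\ m <= y0 - c /\ m <= d - y0).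
  unfold m.
  generalize (Rmin_l (r / 4) (Rmin (Rmin (x0 - a) (b - x0)) (Rmin (y0 - c) (d - y0))))
    (Rmin_r (r / 4) (Rmin (Rmin (x0 - a) (b - x0)) (Rmin (y0 - c) (d - y0))))
    (Rmin_l (Rmin (x0 - a) (b - x0)) (Rmin (y0 - c) (d - y0)))
    (Rmin_r (Rmin (x0 - a) (b - x0)) (Rmin (y0 - c) (d - y0)))
    (Rmin_l (x0 - a) (b - x0)) (Rmin_r (x0 - a) (b - x0))
    (Rmin_l (y0 - c) (d - y0)) (Rmin_r (y0 - c) (d - y0)); lra.
apply Cmod_eq_0.
set (K := Cmod (rect_int f a b c d)) in *.
assert (K0 : 0 <= K) by apply Cmod_ge_0.
destruct (Rle_lt_or_eq_dec _ _ K0) as [Kp | Kp]; auto.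
assert (M0 : 0 < Rabs M + 1) by (generalize (Rabs_pos M); lra).
(* The first bound keeps the small square inside the rectangle and the disc where [f] is bounded;
   the second turns [e * (8 * M)] into at most [K / 2]. *)
set (e := Rmin (m / 2) (K / (16 * (Rabs M + 1)))).
assert (e0 : 0 < e) by (unfold e; apply Rmin_glb_lt; [lra | apply Rdiv_lt_0_compat; lra]).
assert (e1 : e <= m / 2) by apply Rmin_l.
assert (e2 : e <= K / (16 * (Rabs M + 1))) by apply Rmin_r.
assert (HK : K <= e * (8 * M)) by (apply Hsm; lra).
assert (K <= K / 2); [| lra].
eapply Rle_trans; [exact HK |].
apply Rle_trans with (K / (16 * (Rabs M + 1)) * (8 * (Rabs M + 1))).
- apply Rle_trans with (e * (8 * (Rabs M + 1))).
    apply Rmult_le_compat_l; [lra | generalize (Rle_abs M); lra].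
  apply Rmult_le_compat_r; lra.
- right; field; lra.
Qed.

(** * The derivative of a holomorphic function is holomorphic *)

(** Differentiation under the integral sign: the remainder of the integral is the integral of the
    pointwise remainders, and these are quadratically small uniformly on the frame. *)
Lemma is_derive_C_rect_int (E : C -> C -> C) (E1 : C -> C) (z : C) (a b c d M r : R) :
  0 < r -> a <= b -> c <= d ->
  (forall w, Cmod (w - z) < r -> frame a b c d (ex_derive_C (E w))) ->
  frame a b c d (ex_derive_C E1) ->
  (forall w, Cmod (w - z) < r -> frame a b c d (fun zeta =>
    Cmod (E w zeta - E z zeta - (w - z) * E1 zeta)
      <= M * (Cmod (w - z) * Cmod (w - z)))) ->
  is_derive_C (fun w => rect_int (E w) a b c d) z (rect_int E1 a b c d).
Proof.
intros r0 ab cd HE HE1 HM.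
assert (Ez : frame a b c d (ex_derive_C (E z)))
  by (apply HE; unfold Cminus; rewrite Cplus_opp_r, Cmod_0; auto).
set (L := 2 * ((b - a) + (d - c))).
assert (L0 : 0 <= L) by (unfold L; lra).
(* Positive even for a degenerate rectangle or a negative [M], so that [eps / N] is a valid
   radius. *)
set (N := L * (Rabs M) + 1).
assert (N0 : 0 < N)
  by (generalize (Rmult_le_pos _ _ L0 (Rabs_pos M)); unfold N; lra).
apply is_derive_C_eps; intros eps eps0.
exists (Rmin r (eps / N)); split.
  apply Rmin_glb_lt; auto; now apply Rdiv_lt_0_compat.
intros w Hw.
assert (Hw1 : Cmod (w - z) < r) by (eapply Rlt_le_trans; [exact Hw | apply Rmin_l]).
assert (Hw2 : Cmod (w - z) < eps / N) by (eapply Rlt_le_trans; [exact Hw | apply Rmin_r]).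
assert (Hc : forall k f, frame a b c d (ex_derive_C f) ->
  frame a b c d (ex_derive_C (fun zeta => k * f zeta)%C)).
  intros k f; apply frame_imp; intros zeta Hz.
  apply ex_derive_C_mult; auto; apply ex_derive_C_const.
assert (Hp : forall f g, frame a b c d (ex_derive_C f) -> frame a b c d (ex_derive_C g) ->
  frame a b c d (ex_derive_C (fun zeta => f zeta + g zeta)%C)).
  intros f g Hf Hg; apply frame_imp with (2 := frame_and _ _ _ _ _ _ Hf Hg).
  intros zeta [? ?]; now apply ex_derive_C_plus.
(* The differences are written as sums and complex multiples, the shape that [rect_int_plus] and
   [rect_int_scal] split. *)
pose (rem := fun zeta => (E w zeta + ((-1)%R * E z zeta + (- (w - z)) * E1 zeta))%C).
assert (Eq : (rect_int (E w) a b c d - rect_int (E z) a b c d - (w - z) * rect_int E1 a b c d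
  = rect_int rem a b c d)%C).
  unfold rem.
  rewrite (rect_int_plus (E w)), rect_int_plus, !rect_int_scal; auto.
  ring.
rewrite Eq.
eapply Rle_trans.
  apply Cmod_rect_int_le with (M := M * (Cmod (w - z) * Cmod (w - z))); auto.
    unfold rem; auto.
  apply frame_imp with (2 := HM w Hw1); intros zeta Hz.
  replace (rem zeta) with (E w zeta - E z zeta - (w - z) * E1 zeta)%C; auto.
  unfold rem; ring.
fold L.
set (e := Cmod (w - z)) in *.
assert (e0 : 0 <= e) by apply Cmod_ge_0.
replace (L * (M * (e * e))) with (L * M * e * e) by ring.
apply Rmult_le_compat_r; auto.
apply Rle_trans with (N * e).
- apply Rmult_le_compat_r; auto; unfold N.
  generalize (Rmult_le_compat_l _ _ _ L0 (Rle_abs M)); lra.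
- apply Rmult_lt_compat_l with (r := N) in Hw2; auto.
  replace (N * (eps / N)) with eps in Hw2 by (field; lra); lra.
Qed.

(** * Cauchy integrals over a rectangle and their derivatives *)

Lemma frame_dist (a b c d : R) (z : C) : a < fst z < b -> c < snd z < d ->
  exists D, 0 < D /\ frame a b c d (fun zeta => D <= Cmod (zeta - z)).
Proof.
destruct z as [x y]; simpl; intros Hx Hy.
exists (Rmin (Rmin (x - a) (b - x)) (Rmin (y - c) (d - y))).
set (D := Rmin _ _).
assert (HD : D <= x - a /\ D <= b - x /\ D <= y - c /\ D <= d - y).
  unfold D.
  generalize (Rmin_l (Rmin (x - a) (b - x)) (Rmin (y - c) (d - y)))
    (Rmin_r (Rmin (x - a) (b - x)) (Rmin (y - c) (d - y)))
    (Rmin_l (x - a) (b - x)) (Rmin_r (x - a) (b - x))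
    (Rmin_l (y - c) (d - y)) (Rmin_r (y - c) (d - y)); lra.
split; [unfold D; repeat apply Rmin_glb_lt; lra |].
assert (Hr : forall u v, D <= Rabs (u - x) -> D <= Cmod ((u, v) - (x, y))%C).
  intros u v H; eapply Rle_trans; [exact H |].
  exact (Rle_trans _ _ _ (Rmax_l _ _) (Rmax_Cmod ((u, v) - (x, y))%C)).
assert (Hi : forall u v, D <= Rabs (v - y) -> D <= Cmod ((u, v) - (x, y))%C).
  intros u v H; eapply Rle_trans; [exact H |].
  exact (Rle_trans _ _ _ (Rmax_r _ _) (Rmax_Cmod ((u, v) - (x, y))%C)).
split; intros t Ht; split; first
  [ apply Hi; rewrite Rabs_left; lra | apply Hi; rewrite Rabs_right; lra
  | apply Hr; rewrite Rabs_left; lra | apply Hr; rewrite Rabs_right; lra].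
Qed.

(** The Cauchy kernel with density [phi]; [kernel2] and [kernel3] are its first and second
    derivatives in [w]. *)
Definition kernel1 (phi : C -> C) (w zeta : C) : C := (phi zeta * / (zeta - w))%C.
Definition kernel2 (phi : C -> C) (w zeta : C) : C :=
  (phi zeta * (/ (zeta - w) * / (zeta - w)))%C.
Definition kernel3 (phi : C -> C) (w zeta : C) : C :=
  (phi zeta * (2%R * (/ (zeta - w) * / (zeta - w) * / (zeta - w))))%C.

Lemma ex_derive_C_shift_inv (w zeta : C) : zeta <> w ->
  ex_derive_C (fun zeta => / (zeta - w))%C zeta.
Proof.
intros H; apply (ex_derive_C_inv (fun zeta => zeta - w)%C).
- intros E; apply H; replace zeta with ((zeta - w) + w)%C by ring; rewrite E; ring.
- apply ex_derive_C_plus; [apply ex_derive_C_id | apply ex_derive_C_const].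
Qed.

Lemma Cminus_neq_0 (z w : C) : z <> w -> (z - w)%C <> 0%C.
Proof.
intros H E; apply H; replace z with ((z - w) + w)%C by ring; rewrite E; ring.
Qed.

Lemma kernel1_remainder (phi : C -> C) (z w zeta : C) : zeta <> z -> zeta <> w ->
  (kernel1 phi w zeta - kernel1 phi z zeta - (w - z) * kernel2 phi z zeta =
   phi zeta * ((w - z) * (w - z)) * (/ (zeta - w) * / (zeta - z) * / (zeta - z)))%C.
Proof.
intros Hz Hw; apply Cminus_neq_0 in Hz; apply Cminus_neq_0 in Hw.
unfold kernel1, kernel2; field; auto.
Qed.

(** As for [kernel1_remainder], the point is the explicit factor [(w - z) * (w - z)] demanded by
    [is_derive_C_rect_int]; the cofactor is bounded as long as [zeta] stays away from [z] and
    [w]. *)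
Lemma kernel2_remainder (phi : C -> C) (z w zeta : C) : zeta <> z -> zeta <> w ->
  (kernel2 phi w zeta - kernel2 phi z zeta - (w - z) * kernel3 phi z zeta =
   phi zeta * ((w - z) * (w - z)) *
     (2%R * (/ (zeta - w) * / (zeta - z) * (/ (zeta - z) * / (zeta - z)))
      + / (zeta - w) * / (zeta - w) * (/ (zeta - z) * / (zeta - z))))%C.
Proof.
intros Hz Hw; apply Cminus_neq_0 in Hz; apply Cminus_neq_0 in Hw.
unfold kernel2, kernel3; field; auto.
Qed.

(** If the frame is at distance at least [D] from [z], it stays farther than [D / 2] from every [w]
    within [D / 2] of [z]. All inverses are then at most [2 / D], which makes the kernel remainders
    uniformly quadratic. *)
Lemma is_derive_C_cauchy_integral (phi : C -> C) (a b c d Mf : R) (z : C) :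
  a < fst z < b -> c < snd z < d ->
  frame a b c d (ex_derive_C phi) -> frame a b c d (fun zeta => Cmod (phi zeta) <= Mf) ->
  is_derive_C (fun w => rect_int (kernel1 phi w) a b c d) z
    (rect_int (kernel2 phi z) a b c d) /\
  is_derive_C (fun w => rect_int (kernel2 phi w) a b c d) z
    (rect_int (kernel3 phi z) a b c d).
Proof.
intros Hx Hy Hphi HMf.
destruct (frame_dist a b c d z Hx Hy) as [D [D0 HD]].
assert (Dw : forall w zeta, Cmod (w - z) < D / 2 -> D <= Cmod (zeta - z) ->
  D / 2 < Cmod (zeta - w)).
  intros w zeta Hw Hz.
  assert (Cmod (zeta - z) <= Cmod (zeta - w) + Cmod (w - z)); [| lra].
  replace (zeta - z)%C with ((zeta - w) + (w - z))%C by ring; apply Cmod_triangle.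
assert (Nw : forall w zeta, D / 2 < Cmod (zeta - w) -> zeta <> w).
  intros w zeta Hw ->; replace (w - w)%C with (RtoC 0) in Hw by ring.
  rewrite Cmod_0 in Hw; lra.
assert (Iw : forall w zeta, D / 2 < Cmod (zeta - w) -> Cmod (/ (zeta - w)) <= 2 / D).
  intros w zeta Hw; rewrite Cmod_inv by now apply Cminus_neq_0, Nw.
  replace (2 / D) with (/ (D / 2)) by (field; lra).
  apply Rinv_le_contravar; lra.
set (B := 2 / D) in *.
assert (B0 : 0 < B) by (apply Rdiv_lt_0_compat; lra).
assert (zz : Cmod (z - z) < D / 2)
  by (replace (z - z)%C with (RtoC 0) by ring; rewrite Cmod_0; lra).
assert (F1 : forall w, Cmod (w - z) < D / 2 -> frame a b c d (ex_derive_C (kernel1 phi w))).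
  intros w Hw; apply frame_imp with (2 := frame_and _ _ _ _ _ _ Hphi HD).
  intros zeta [H1 H2]; apply ex_derive_C_mult; auto.
  apply ex_derive_C_shift_inv; eauto.
assert (F2 : forall w, Cmod (w - z) < D / 2 -> frame a b c d (ex_derive_C (kernel2 phi w))).
  intros w Hw; apply frame_imp with (2 := frame_and _ _ _ _ _ _ Hphi HD).
  intros zeta [H1 H2]; apply ex_derive_C_mult; auto.
  apply ex_derive_C_mult; apply ex_derive_C_shift_inv; eauto.
assert (F3 : frame a b c d (ex_derive_C (kernel3 phi z))).
  apply frame_imp with (2 := frame_and _ _ _ _ _ _ Hphi HD).
  intros zeta [H1 H2]; apply ex_derive_C_mult; auto.
  apply ex_derive_C_mult; [apply ex_derive_C_const |].
  apply ex_derive_C_mult; [apply ex_derive_C_mult |]; apply ex_derive_C_shift_inv; eauto.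
assert (Bd : forall (p h q : C) (N : R), Cmod p <= Mf -> Cmod q <= N ->
  Cmod (p * (h * h) * q) <= Mf * N * (Cmod h * Cmod h)).
  intros p h q N Hp Hq; rewrite !Cmod_mult.
  replace (Mf * N * (Cmod h * Cmod h)) with (Mf * (Cmod h * Cmod h) * N) by ring.
  assert (0 <= Cmod h * Cmod h) by (apply Rmult_le_pos; apply Cmod_ge_0).
  apply Rmult_le_compat; auto using Cmod_ge_0.
  - apply Rmult_le_pos; auto using Cmod_ge_0.
  - now apply Rmult_le_compat_r.
assert (Pr : forall u v p q, Cmod u <= p -> Cmod v <= q -> Cmod (u * v) <= p * q).
  intros u v p q Hu Hv; rewrite Cmod_mult; apply Rmult_le_compat; auto using Cmod_ge_0.
split.
- apply is_derive_C_rect_int with (M := Mf * (B * B * B)) (r := D / 2); auto; try lra.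
  intros w Hw; apply frame_imp with (2 := frame_and _ _ _ _ _ _ HMf HD).
  intros zeta [H1 H2].
  assert (Hwz := Dw w zeta Hw H2); assert (Hzz := Dw z zeta zz H2).
  rewrite kernel1_remainder by eauto.
  apply Bd; auto.
- apply is_derive_C_rect_int with (M := Mf * (2 * (B * B * (B * B)) + B * B * (B * B)))
    (r := D / 2); auto; try lra.
  intros w Hw; apply frame_imp with (2 := frame_and _ _ _ _ _ _ HMf HD).
  intros zeta [H1 H2].
  assert (Hwz := Dw w zeta Hw H2); assert (Hzz := Dw z zeta zz H2).
  rewrite kernel2_remainder by eauto.
  apply Bd; auto.
  eapply Rle_trans; [apply Cmod_triangle |].
  apply Rplus_le_compat; auto.
  apply Pr; auto; rewrite Cmod_R, Rabs_right; lra.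
Qed.

(** The quotient [(f zeta - f z) / (zeta - z)] is holomorphic off [z] and bounded near it, so
    [goursat_punctured] makes its integral vanish; linearity separates the two terms. *)
Lemma cauchy_square (f : C -> C) (z : C) (a b c d : R) :
  a < fst z < b -> c < snd z < d ->
  (forall x y, a <= x <= b -> c <= y <= d -> ex_derive_C f (x, y)) ->
  rect_int (kernel1 f z) a b c d =
    (f z * rect_int (kernel1 (fun _ => 1%R) z) a b c d)%C.
Proof.
destruct z as [x0 y0]; simpl; intros Hx Hy Hf; set (z := (x0, y0) : C).
destruct (frame_dist a b c d z Hx Hy) as [D [D0 HD]].
assert (HN : frame a b c d (fun zeta => zeta <> z)).
  apply frame_imp with (2 := HD); intros zeta H ->.
  replace (z - z)%C with (RtoC 0) in H by ring; rewrite Cmod_0 in H; lra.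
assert (Ff : frame a b c d (ex_derive_C f)) by (apply frame_of_rect; auto; lra).
assert (K1 : forall phi, frame a b c d (ex_derive_C phi) ->
  frame a b c d (ex_derive_C (kernel1 phi z))).
  intros phi Hphi; apply frame_imp with (2 := frame_and _ _ _ _ _ _ Hphi HN).
  intros zeta [H1 H2]; apply ex_derive_C_mult; auto; now apply ex_derive_C_shift_inv.
assert (F1 : frame a b c d (ex_derive_C (fun _ => 1%R : C)))
  by (apply frame_of_rect; try lra; intros; apply ex_derive_C_const).
pose (k := fun zeta => kernel1 (fun zeta => f zeta - f z)%C z zeta).
assert (E : rect_int k a b c d = 0%C).
  destruct (ex_derive_C_locally_bounded f z) as [M [r [r0 Hr]]]; [apply Hf; lra |].
  apply (goursat_punctured k x0 y0 a b c d M r); auto.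
  - intros x y Hx' Hy' N; apply ex_derive_C_mult; [| now apply ex_derive_C_shift_inv].
    apply ex_derive_C_plus; [auto | apply ex_derive_C_const].
  - intros zeta N Hz; unfold k, kernel1; fold z in Hz, N.
    assert (N' := Cminus_neq_0 _ _ N).
    assert (P : 0 < Cmod (zeta - z)) by now apply Cmod_gt_0.
    rewrite Cmod_mult, Cmod_inv by auto.
    apply Rmult_le_reg_r with (Cmod (zeta - z)); auto.
    rewrite Rmult_assoc, Rinv_l, Rmult_1_r by lra; auto.
assert (E2 : rect_int k a b c d = (rect_int (kernel1 f z) a b c d +
  (- f z) * rect_int (kernel1 (fun _ => 1%R) z) a b c d)%C).
  rewrite <- rect_int_scal by (try lra; auto).
  rewrite <- (rect_int_plus (kernel1 f z)
    (fun zeta => - f z * kernel1 (fun _ => 1%R) z zeta)%C); [| lra | lra | now apply K1 |].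
  - apply rect_int_ext; try lra; apply frame_of_rect; try lra; intros x y _ _.
    unfold k, kernel1; ring.
  - apply frame_imp with (2 := K1 _ F1); intros zeta H.
    apply ex_derive_C_mult; auto; apply ex_derive_C_const.
rewrite E in E2.
replace (rect_int (kernel1 f z) a b c d) with (0 + f z * rect_int (kernel1 (fun _ => 1%R) z) a b c d)%C.
  ring.
rewrite E2; ring.
Qed.

(** * The integral of 1/(zeta - z) around a centred square *)

Lemma Im_RIntC_ge (g : R -> C) (k : C) (a b m : R) : a <= b -> ex_RIntC g a b ->
  (forall t, a <= t <= b -> m <= Im (k * g t)) -> (b - a) * m <= Im (k * RIntC g a b).
Proof.
intros ab Hg H.
assert (K := is_RIntC_Cmult g a b k _ (RInt_correct (V := C_R_CompleteNormedModule) g a b Hg)).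
apply (is_RInt_fct_extend_snd (U := R_NormedModule) (V := R_NormedModule)) in K.
apply (is_RInt_le (fun _ => m) (fun t => Im (k * g t)) a b); auto.
- exact (is_RInt_const (V := R_NormedModule) a b m).
- intros t Ht; apply H; lra.
Qed.

(** Each side contributes at least 1 to the imaginary part: with [tau] the coordinate along the side
    measured from its midpoint, the integrand has imaginary part [s / (tau ^ 2 + s ^ 2)], at least
    [/ (2 * s)], on a length [2 * s]. *)
Lemma winding_square_neq_0 (x0 y0 s : R) : 0 < s ->
  rect_int (kernel1 (fun _ => 1%R) (x0, y0)) (x0 - s) (x0 + s) (y0 - s) (y0 + s) <> 0%C.
Proof.
intros s0.
destruct (frame_dist (x0 - s) (x0 + s) (y0 - s) (y0 + s) (x0, y0)) as [D [D0 HD]];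
  try (simpl; lra).
assert (F : frame (x0 - s) (x0 + s) (y0 - s) (y0 + s)
  (ex_derive_C (kernel1 (fun _ => 1%R) (x0, y0)))).
  apply frame_imp with (2 := HD); intros zeta H.
  apply ex_derive_C_mult; [apply ex_derive_C_const | apply ex_derive_C_shift_inv].
  intros ->; replace ((x0, y0) - (x0, y0))%C with (RtoC 0) in H by ring.
  rewrite Cmod_0 in H; lra.
apply frame_ex_RInt in F; try lra.
destruct F as [[R1 R2] [R3 R4]].
assert (Q : forall tau, - s <= tau <= s -> / (2 * s) <= s / (tau ^ 2 + s ^ 2)).
  intros tau Ht.
  assert (tau ^ 2 <= s ^ 2) by nra.
  assert (0 < s ^ 2) by nra.
  assert (0 <= tau ^ 2) by nra.
  replace (/ (2 * s)) with (s / (s ^ 2 + s ^ 2)) by (field; lra).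
  apply Rmult_le_compat_l; [lra |]; apply Rinv_le_contravar; lra.
assert (s2 : 0 < s * s) by nra.
assert (sq : forall u, 0 <= u * u) by (intros u; nra).
intros E.
(* The factors 1, -1, [Ci] and [- Ci] in [H1] to [H4] are the weights of the four sides in
   [rect_int], so the four bounds add up to an imaginary part of at least 4. *)
assert (H1 : 1 <= Im (1%R * RIntC (fun x => kernel1 (fun _ => 1%R) (x0, y0) (x, y0 - s))
   (x0 - s) (x0 + s))).
  replace 1 with ((x0 + s - (x0 - s)) * / (2 * s)) at 1 by (field; lra).
  apply Im_RIntC_ge; [lra | auto |]; intros t Ht.
  specialize (sq (t - x0)).
  eapply Rle_trans; [apply (Q (t - x0)); lra |]; right.
  unfold kernel1; simpl; field; apply Rgt_not_eq; nra.
assert (H2 : 1 <= Im ((-1)%R * RIntC (fun x => kernel1 (fun _ => 1%R) (x0, y0) (x, y0 + s))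
   (x0 - s) (x0 + s))).
  replace 1 with ((x0 + s - (x0 - s)) * / (2 * s)) at 1 by (field; lra).
  apply Im_RIntC_ge; [lra | auto |]; intros t Ht.
  specialize (sq (t - x0)).
  eapply Rle_trans; [apply (Q (t - x0)); lra |]; right.
  unfold kernel1; simpl; field; apply Rgt_not_eq; nra.
assert (H3 : 1 <= Im (Ci * RIntC (fun y => kernel1 (fun _ => 1%R) (x0, y0) (x0 + s, y))
   (y0 - s) (y0 + s))).
  replace 1 with ((y0 + s - (y0 - s)) * / (2 * s)) at 1 by (field; lra).
  apply Im_RIntC_ge; [lra | auto |]; intros t Ht.
  specialize (sq (t - y0)).
  eapply Rle_trans; [apply (Q (t - y0)); lra |]; right.
  unfold kernel1; simpl; field; apply Rgt_not_eq; nra.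
assert (H4 : 1 <= Im ((- Ci) * RIntC (fun y => kernel1 (fun _ => 1%R) (x0, y0) (x0 - s, y))
   (y0 - s) (y0 + s))).
  replace 1 with ((y0 + s - (y0 - s)) * / (2 * s)) at 1 by (field; lra).
  apply Im_RIntC_ge; [lra | auto |]; intros t Ht.
  specialize (sq (t - y0)).
  eapply Rle_trans; [apply (Q (t - y0)); lra |]; right.
  unfold kernel1; simpl; field; apply Rgt_not_eq; nra.
unfold rect_int in E.
apply (f_equal Im) in E.
revert H1 H2 H3 H4 E.
generalize (RIntC (fun x => kernel1 (fun _ => 1%R) (x0, y0) (x, y0 - s)) (x0 - s) (x0 + s)).
generalize (RIntC (fun x => kernel1 (fun _ => 1%R) (x0, y0) (x, y0 + s)) (x0 - s) (x0 + s)).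
generalize (RIntC (fun y => kernel1 (fun _ => 1%R) (x0, y0) (x0 + s, y)) (y0 - s) (y0 + s)).
generalize (RIntC (fun y => kernel1 (fun _ => 1%R) (x0, y0) (x0 - s, y)) (y0 - s) (y0 + s)).
intros [u1 v1] [u2 v2] [u3 v3] [u4 v4]; simpl; lra.
Qed.

(** On a small square Cauchy's formula reads [A1 = f * W1]. As [W1] is nonzero near the centre, the
    quotient rule writes [C_derive f] there through [A1], [A2], [W1], [W2], all differentiable at
    [z0]. *)
Lemma ex_derive_C_derive (V : C -> Prop) (f : C -> C) (z0 : C) :
  holomorphic_on V f -> V z0 -> ex_derive_C (C_derive f) z0.
Proof.
intros [oV Hf] Vz0.
assert (L : locally (T := C_UniformSpace) z0
  (fun z => V z /\ Cmod (f z - f z0) < 1)).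
  apply filter_and; [now apply oV |].
  apply ex_derive_C_continuous; [now apply Hf | lra].
apply locally_Cmod in L; destruct L as [r [r0 Hr]].
destruct z0 as [x0 y0].
(* Points of the square are within [s + s < r] of the centre, hence in [V] and where [f] is
   bounded. *)
set (s := r / 3); set (a := x0 - s); set (b := x0 + s); set (c := y0 - s); set (d := y0 + s).
set (z0 := (x0, y0) : C).
assert (s0 : 0 < s) by (unfold s; lra).
assert (Box : forall x y, a <= x <= b -> c <= y <= d ->
  V (x, y) /\ Cmod (f (x, y) - f z0) < 1).
  intros x y Hx Hy; apply Hr; apply Rle_lt_trans with (s + s); [| unfold s; lra].
  apply Cmod_pair_le; apply Rabs_le; unfold a, b, c, d in *; lra.
assert (ab : a <= b) by (unfold a, b; lra).
assert (cd : c <= d) by (unfold c, d; lra).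
assert (HD : forall x y, a <= x <= b -> c <= y <= d -> ex_derive_C f (x, y))
  by (intros x y Hx Hy; apply Hf; now apply Box).
assert (Ff : frame a b c d (ex_derive_C f)) by now apply frame_of_rect.
assert (Fb : frame a b c d (fun zeta => Cmod (f zeta) <= 1 + Cmod (f z0))).
  apply frame_of_rect; auto; intros x y Hx Hy.
  replace (f (x, y)) with ((f (x, y) - f z0) + f z0)%C by ring.
  eapply Rle_trans; [apply Cmod_triangle |]; generalize (proj2 (Box x y Hx Hy)); lra.
assert (Oned : frame a b c d (ex_derive_C (fun _ => RtoC 1)))
  by (apply frame_of_rect; auto; intros; apply ex_derive_C_const).
assert (Oneb : frame a b c d (fun zeta => Cmod ((fun _ => RtoC 1) zeta) <= 1))
  by (apply frame_of_rect; auto; intros; rewrite Cmod_1; lra).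
set (A1 := fun z => rect_int (kernel1 f z) a b c d).
set (A2 := fun z => rect_int (kernel2 f z) a b c d).
set (W1 := fun z => rect_int (kernel1 (fun _ => RtoC 1) z) a b c d).
set (W2 := fun z => rect_int (kernel2 (fun _ => RtoC 1) z) a b c d).
pose (inside := fun z : C => a < fst z < b /\ c < snd z < d).
assert (Hin : locally (T := C_UniformSpace) z0 inside).
  exists (mkposreal s s0); intros [x y] [Hx Hy].
  apply Rabs_def2 in Hx; apply Rabs_def2 in Hy; unfold inside, a, b, c, d.
  simpl in *; unfold minus, plus, opp in *; simpl in *; lra.
assert (iz0 : inside z0) by (unfold inside, a, b, c, d; simpl; lra).
assert (DA1 : forall z, inside z -> is_derive_C A1 z (A2 z))
  by (intros z [Hx Hy]; exact (proj1 (is_derive_C_cauchy_integral f a b c d _ z Hx Hy Ff Fb))).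
assert (DW1 : forall z, inside z -> is_derive_C W1 z (W2 z))
  by (intros z [Hx Hy]; exact (proj1 (is_derive_C_cauchy_integral _ a b c d _ z Hx Hy Oned Oneb))).
assert (DA2 : forall z, inside z -> ex_derive_C A2 z)
  by (intros z [Hx Hy]; eexists;
      exact (proj2 (is_derive_C_cauchy_integral f a b c d _ z Hx Hy Ff Fb))).
assert (DW2 : forall z, inside z -> ex_derive_C W2 z)
  by (intros z [Hx Hy]; eexists;
      exact (proj2 (is_derive_C_cauchy_integral _ a b c d _ z Hx Hy Oned Oneb))).
assert (W0 : W1 z0 <> 0%C) by exact (winding_square_neq_0 x0 y0 s s0).
assert (Hf1 : forall z, inside z /\ W1 z <> 0%C -> (A1 z * / W1 z)%C = f z).
  intros z [[Hx Hy] Wz]; unfold A1; rewrite (cauchy_square f z a b c d) by auto.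
  change (f z * W1 z * / W1 z = f z)%C; field; auto.
clearbody A1 A2 W1 W2.
assert (Hloc : locally (T := C_UniformSpace) z0 (fun z => inside z /\ W1 z <> 0%C)).
  apply filter_and; auto; apply ex_derive_C_nonzero; auto.
  exists (W2 z0); auto.
pose (D1 := fun z => (A2 z * / W1 z + A1 z * - (W2 z * (/ W1 z * / W1 z)))%C).
assert (Hd : locally (T := C_UniformSpace) z0 (fun z => D1 z = C_derive f z)).
  (* Computing the derivative at a nearby [z] needs [f = A1 / W1] on a whole neighbourhood of that
     [z]. *)
  apply locally_locally in Hloc.
  apply filter_imp with (2 := Hloc); intros z Hz.
  destruct (locally_singleton _ _ Hz) as [iz Wz].
  symmetry; apply is_C_derive_unique.
  apply is_derive_C_ext_loc with (f := fun z => (A1 z * / W1 z)%C).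
    apply filter_imp with (2 := Hz); exact Hf1.
  apply (is_derive_C_mult A1 (fun z => / W1 z)%C); auto.
  apply is_derive_C_inv; auto.
assert (DD : ex_derive_C D1 z0).
  assert (EW : ex_derive_C (fun z => / W1 z)%C z0)
    by (apply ex_derive_C_inv; auto; exists (W2 z0); auto).
  apply ex_derive_C_plus; apply ex_derive_C_mult; auto.
  - exists (A2 z0); auto.
  - apply ex_derive_C_ext with (f := fun z => (RtoC (-1) * (W2 z * (/ W1 z * / W1 z)))%C).
      intros w; ring.
    apply ex_derive_C_mult; [apply ex_derive_C_const |].
    apply ex_derive_C_mult; [auto | apply ex_derive_C_mult; auto].
destruct DD as [l Hl]; exists l.
exact (is_derive_C_ext_loc _ _ _ _ Hd Hl).
Qed.

(** * Second derivatives along vertical lines *)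

Lemma is_derive_Re (f : R -> C) (t : R) (l : C) :
  @is_derive R_AbsRing C_R_NormedModule f t l -> is_derive (fun s => Re (f s)) t (Re l).
Proof.
intros H.
apply (filterdiff_ext_lin (fun s => Re (f s)) (fun y => fst (scal (V := C_R_NormedModule) y l))).
- exact (filterdiff_comp' f (fst : C_R_NormedModule -> R_NormedModule) t _ fst H
    (filterdiff_linear fst (is_linear_fst (U := R_NormedModule) (V := R_NormedModule)))).
- reflexivity.
Qed.

Lemma is_derive_Re_point (f : C -> C) (sigma t : R) (l : C) :
  is_derive_C f (point sigma t) l ->
  is_derive (fun s => Re (f (point sigma s))) t (Re (Ci * l)).
Proof.
assert (E : forall s : R, (sigma + s * Ci = point sigma s)%C)
  by (intros s; unfold point; ring).
intros H; rewrite <- E in H; apply is_derive_C_line, is_derive_Re in H.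
apply is_derive_ext with (2 := H); intros s; cbv beta; now rewrite E.
Qed.

Lemma locally_point (P : C -> Prop) (sigma t : R) :
  locally (T := C_UniformSpace) (point sigma t) P -> locally t (fun s => P (point sigma s)).
Proof.
intros H; apply locally_Cmod in H; destruct H as [r [r0 Hr]].
exists (mkposreal r r0); intros s Hs; apply Hr.
replace (point sigma s - point sigma t)%C with (Ci * RtoC (s - t))%C
  by (unfold point; rewrite RtoC_minus; ring).
rewrite Cmod_mult, Cmod_Ci, Cmod_R, Rmult_1_l; exact Hs.
Qed.

(** Each derivative in the ordinate brings out a factor [Ci], and two of them give the sign -1. *)
Lemma second_derivative_Re_vertical (v : R -> R) (D : R -> Prop) (Q Q1 : C -> C)
  (sigma t : R) (l : C) (O : C -> Prop) :
  locally (T := C_UniformSpace) (point sigma t) O ->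
  (forall s, O (point sigma s) -> D s /\ v s = Re (Q (point sigma s))) ->
  (forall z, O z -> is_derive_C Q z (Q1 z)) -> is_derive_C Q1 (point sigma t) l ->
  twice_derivable_at D v t /\ Derive_n v 2 t = - Re l.
Proof.
intros HO HD HQ HQ1.
(* The first derivative is identified on a neighbourhood of [t]: this gives the local part of
   [twice_derivable_at] and allows [Derive] to be differentiated again. *)
assert (H1 : locally t (fun s => D s /\ is_derive v s (Re (Ci * Q1 (point sigma s))))).
  apply locally_locally in HO.
  apply locally_point in HO; apply filter_imp with (2 := HO); intros s Hs.
  assert (Os := locally_singleton _ _ Hs).
  split; [now apply HD |].
  apply is_derive_ext_loc with (f := fun s => Re (Q (point sigma s))).
  - apply locally_point in Hs; apply filter_imp with (2 := Hs); intros s' Hs'.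
    symmetry; now apply HD.
  - apply is_derive_Re_point; auto.
assert (H2 : is_derive (Derive_n v 1) t (- Re l)).
  apply is_derive_ext_loc with (f := fun s => Re (Ci * Q1 (point sigma s))).
  - apply filter_imp with (2 := H1); intros s [_ Hs]; symmetry.
    exact (is_derive_unique _ _ _ Hs).
  - replace (- Re l) with (Re (Ci * (Ci * l))) by (destruct l; simpl; ring).
    apply (is_derive_Re_point (fun z => Ci * Q1 z)%C).
    eapply is_derive_C_eq; [exact (is_derive_C_mult _ _ _ _ _ (is_derive_C_const Ci _) HQ1) |].
    change (RtoC 0 * Q1 (point sigma t) + Ci * l = Ci * l)%C; ring.
split; [split |].
- apply filter_imp with (2 := H1); intros s [Ds Hs]; split; auto; eexists; exact Hs.
- eexists; exact H2.
- exact (is_derive_unique _ _ _ H2).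
Qed.

(** Dividing by [z - rho] instead of lowering the exponent avoids the truncated predecessor at
    [n = 0] and is the form that cancels in [F' / F]. *)
Lemma is_derive_C_pow (rho z : C) (n : nat) : z <> rho ->
  is_derive_C (fun w => (w - rho) ^ n)%C z (INR n * (z - rho) ^ n * / (z - rho))%C.
Proof.
intros N; apply Cminus_neq_0 in N.
induction n as [|n IH].
- eapply is_derive_C_eq; [apply (is_derive_C_const (RtoC 1)) |]; simpl; ring.
- assert (D1 : is_derive_C (fun w => w - rho)%C z (RtoC 1 + RtoC 0)%C)
    by (apply is_derive_C_plus; [apply is_derive_C_id | apply is_derive_C_const]).
  eapply is_derive_C_eq; [exact (is_derive_C_mult _ _ _ _ _ D1 IH) |].
  cbv beta; rewrite S_INR, RtoC_plus, Cpow_S; field; auto.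
Qed.

(** The logarithmic derivative turns the product [(z - rho) ^ m * g z] into a sum; [O] is the part
    of the common domain where [g] does not vanish, and [q = g' / g] there. *)
Lemma log_derivative_near_zero (U : C -> Prop) (F : C -> C) (rho : C) (m : nat) :
  holomorphic_on U F -> U rho -> zero_of_order F rho m ->
  exists (O : C -> Prop) (q q1 q2 : C -> C),
    open (T := C_UniformSpace) O /\ O rho /\ ex_derive_C q2 rho /\
    (forall z, O z -> is_derive_C q z (q1 z) /\ is_derive_C q1 z (q2 z)) /\
    (forall z, O z -> z <> rho -> U z /\ F z <> 0%C /\
       (C_derive F z / F z = RtoC (INR m) * / (z - rho) + q z)%C).
Proof.
intros [oU HF] Urho [_ [V [g [Vrho [[oV Hg] [g0 EF]]]]]].
pose (O := fun z => (U z /\ V z) /\ g z <> 0%C).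
assert (oO : open (T := C_UniformSpace) O).
  intros z [[Uz Vz] gz]; apply filter_and; [apply filter_and; auto |].
  apply ex_derive_C_nonzero; auto.
assert (Hg1 : forall z, V z -> ex_derive_C (C_derive g) z)
  by (intros z Vz; apply (ex_derive_C_derive V g z); auto; split; auto).
pose (q := fun z => (C_derive g z * / g z)%C).
assert (Hq : holomorphic_on O q).
  split; auto; intros z [[Uz Vz] gz]; apply ex_derive_C_mult; auto.
  apply ex_derive_C_inv; auto.
(* Holomorphy is passed on to [q'] and then to [q'']; the latter makes [q''] continuous, hence
   bounded near [rho]. *)
assert (Hq1 : holomorphic_on O (C_derive q))
  by (split; auto; intros z Oz; now apply (ex_derive_C_derive O q)).
assert (Hq2 : holomorphic_on O (C_derive (C_derive q)))
  by (split; auto; intros z Oz; now apply (ex_derive_C_derive O (C_derive q))).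
assert (Orho : O rho) by (unfold O; auto).
exists O, q, (C_derive q), (C_derive (C_derive q)); split; auto; split; auto.
split; [now apply Hq2 | split].
- intros z Oz; split; apply C_derive_correct; auto; [now apply Hq | now apply Hq1].
- intros z [[Uz Vz] gz] N.
  assert (N' := Cminus_neq_0 _ _ N).
  assert (P : ((z - rho) ^ m)%C <> 0%C) by now apply Cpow_nz.
  assert (Fz : F z <> 0%C) by (rewrite EF by auto; now apply Cmult_neq_0).
  split; auto; split; auto.
  assert (DF : is_derive_C F z
    (INR m * (z - rho) ^ m * / (z - rho) * g z + (z - rho) ^ m * C_derive g z)%C).
    apply is_derive_C_ext_loc with (f := fun w => ((w - rho) ^ m * g w)%C).
      apply filter_imp with (2 := oV z Vz); intros w Vw; symmetry; auto.
    apply is_derive_C_mult; [now apply is_derive_C_pow |].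
    apply C_derive_correct; auto.
  rewrite (is_C_derive_unique _ _ _ DF), EF by auto; unfold q; field; auto.
Qed.

(** A signed offset [e] treats both sides of the zero at once: the second derivative is
    [- (2 * INR m / e ^ 3 + Re (q2 z))], and multiplied by [e] its polar part becomes
    [- 2 * INR m / e ^ 2], negative on either side. *)
Lemma vertical_second_derivative_sign (U : C -> Prop) (F : C -> C) (beta gamma : R) (m : nat) :
  holomorphic_on U F -> U (point beta gamma) -> zero_of_order F (point beta gamma) m ->
  exists a0, 0 < a0 /\ forall e, e <> 0 -> Rabs e < a0 ->
    twice_derivable_at (u_defined U F (beta + e)) (u F (beta + e)) gamma /\
    e * Derive_n (u F (beta + e)) 2 gamma < 0.
Proof.
intros HF HU Hm.
assert (m1 : 1 <= INR m) by (change 1 with (INR 1); apply le_INR, Hm).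
set (rho := point beta gamma) in *.
destruct (log_derivative_near_zero U F rho m HF HU Hm)
  as (O & q & q1 & q2 & oO & Orho & Hq2 & Hq & HO).
assert (L := filter_and _ _ (oO rho Orho) (ex_derive_C_continuous q2 rho 1 Hq2 Rlt_0_1)).
apply locally_Cmod in L; destruct L as [r [r0 Hr]].
set (M := 1 + Cmod (q2 rho)).
assert (M1 : 1 <= M) by (unfold M; generalize (Cmod_ge_0 (q2 rho)); lra).
(* Within [r] of [rho] the modulus of [q2] is at most [M]; [Rabs e < / M] makes the regular
   contribution smaller than 1, and also [Rabs e < 1] because [M >= 1]. *)
exists (Rmin r (/ M)); split; [apply Rmin_glb_lt; auto; apply Rinv_0_lt_compat; lra |].
intros e e0 He.
assert (He1 : Rabs e < r) by (eapply Rlt_le_trans; [exact He | apply Rmin_l]).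
assert (He2 : Rabs e < / M) by (eapply Rlt_le_trans; [exact He | apply Rmin_r]).
assert (Ez : (point (beta + e) gamma - rho = RtoC e)%C)
  by (unfold rho, point; rewrite RtoC_plus; ring).
set (z := point (beta + e) gamma) in *.
destruct (Hr z) as [Oz Hz]; [rewrite Ez, Cmod_R; auto |].
assert (Nsig : forall s, point (beta + e) s <> rho).
  intros s E; apply (f_equal Re) in E; unfold rho, point in E; simpl in E.
  apply e0; lra.
pose (i := fun w => (/ (w - rho))%C).
assert (Di : forall w, w <> rho -> is_derive_C i w (- (i w * i w))%C).
  intros w N; eapply is_derive_C_eq.
  - apply (is_derive_C_inv (fun w => w - rho)%C); [now apply Cminus_neq_0 |].
    apply is_derive_C_plus; [apply is_derive_C_id | apply is_derive_C_const].
  - unfold i; ring.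
set (mC := RtoC (INR m)).
(* [Q] is [F' / F] off [rho] and [Q1] its derivative; since [z - rho = e], the polar part of the
   second derivative at [z] is [2 * INR m / e ^ 3]. *)
pose (Q := fun w => (mC * i w + q w)%C).
pose (Q1 := fun w => (- mC * (i w * i w) + q1 w)%C).
destruct (second_derivative_Re_vertical (u F (beta + e)) (u_defined U F (beta + e))
  Q Q1 (beta + e) gamma (RtoC (2 * INR m / e ^ 3) + q2 z)%C (fun w => O w /\ w <> rho))
  as [HT HD].
- apply filter_and; [now apply oO |].
  assert (locally (T := C_UniformSpace) z (fun w => (w - rho)%C <> 0%C)).
    apply (ex_derive_C_nonzero (fun w => w - rho)%C).
    + apply ex_derive_C_plus; [apply ex_derive_C_id | apply ex_derive_C_const].
    + apply Cminus_neq_0, Nsig.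
  apply filter_imp with (2 := H); intros w Hw E; apply Hw.
  rewrite (E : w = rho); unfold Cminus; apply Cplus_opp_r.
- intros s [Os Ns]; destruct (HO _ Os Ns) as (H1 & H2 & H3); split; [split; auto |].
  unfold u; rewrite H3; reflexivity.
- intros w [Ow Nw]; eapply is_derive_C_eq.
  + exact (is_derive_C_plus _ _ _ _ _
      (is_derive_C_mult _ _ _ _ _ (is_derive_C_const mC _) (Di w Nw)) (proj1 (Hq w Ow))).
  + change (RtoC 0 * i w + mC * - (i w * i w) + q1 w = - mC * (i w * i w) + q1 w)%C; ring.
- eapply is_derive_C_eq.
  + exact (is_derive_C_plus _ _ _ _ _
      (is_derive_C_mult _ _ _ _ _ (is_derive_C_const (- mC)%C _)
        (is_derive_C_mult _ _ _ _ _ (Di z (Nsig gamma)) (Di z (Nsig gamma))))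
      (proj2 (Hq z Oz))).
  + change (RtoC 0 * (i z * i z) + - mC * (- (i z * i z) * i z + i z * - (i z * i z)) + q2 z
      = RtoC (2 * INR m / e ^ 3) + q2 z)%C.
    f_equal; unfold i; rewrite Ez, RtoC_div, RtoC_mult, RtoC_pow by (apply pow_nonzero; auto).
    fold mC; field; intros E; apply RtoC_inj in E; auto.
- split; auto.
  rewrite HD, re_plus, re_RtoC.
  assert (B : Rabs (Re (q2 z)) <= M).
    eapply Rle_trans; [apply re_le_Cmod |].
    replace (q2 z) with ((q2 z - q2 rho) + q2 rho)%C by ring.
    eapply Rle_trans; [apply Cmod_triangle |]; unfold M; lra.
  assert (a1 : 0 < Rabs e) by now apply Rabs_pos_lt.
  assert (a2 : Rabs e * M < 1).
    apply Rmult_lt_compat_r with (r := M) in He2; [| lra].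
    rewrite Rinv_l in He2 by lra; auto.
  assert (a3 : Rabs e < 1) by nra.
  assert (a4 : 0 < e ^ 2 < 1).
    rewrite <- (pow2_abs e); split; nra.
  assert (a5 : 1 <= / e ^ 2) by (rewrite <- Rinv_1; apply Rinv_le_contravar; lra).
  assert (a6 : - (e * Re (q2 z)) <= Rabs e * M).
    eapply Rle_trans; [apply Rle_abs |]; rewrite Rabs_Ropp, Rabs_mult.
    apply Rmult_le_compat_l; lra.
  (* The first term is at most -2, from [m1] and [a5], and the second is below 1. *)
  replace (e * - (2 * INR m / e ^ 3 + Re (q2 z))) with
    (- (2 * INR m * / e ^ 2) + - (e * Re (q2 z))) by (field; auto).
  nra.
Qed.

(** * Strict concavity against a positive second derivative, and the conclusion *)

Lemma strictly_concave_second_derivative (f : R -> R) (x r : R) : 0 < r ->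
  (forall t, Rabs (t - x) < r -> ex_derive f t) -> ex_derive_n f 2 x ->
  strictly_concave_on (fun t => Rabs (t - x) < r) f -> Derive_n f 2 x <= 0.
Proof.
(* If [f''(x) > 0], then near [x] the slopes to the right are at least [f'(x)] and those to the left
   at most [f'(x)]; so [f x] is at most the mean of [f (x - h)] and [f (x + h)]. *)
intros r0 Df D2 Hc; apply Rnot_lt_le; intros Hpos.
set (D := Derive_n f 2 x) in *.
assert (HD : is_derive (Derive f) x D) by exact (Derive_correct _ _ D2).
destruct HD as [_ HD].
(* Taking the error to be [D] itself is just enough for [Derive f t - Derive f x] to have weakly the
   sign of [t - x]. *)
destruct (HD x (fun P HP => HP) (mkposreal D Hpos)) as [d Hd].
assert (K : forall t, Rabs (t - x) < d ->
  Rabs (Derive f t - Derive f x - (t - x) * D) <= D * Rabs (t - x)) by exact Hd.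
clear Hd HD.
set (h := Rmin r d / 2).
assert (h0 : 0 < h) by (assert (0 < Rmin r d) by (apply Rmin_glb_lt; auto; apply cond_pos);
  unfold h; lra).
assert (h1 : h < r /\ h < d)
  by (generalize (Rmin_l r d) (Rmin_r r d); unfold h in *; lra).
assert (MV : forall p q, x - h <= p <= q -> q <= x + h -> exists c, p <= c <= q /\
  f q - f p = Derive f c * (q - p)).
  intros p q Hp Hq.
  assert (E : forall t, p <= t <= q -> is_derive f t (Derive f t)).
    intros t Ht; apply Derive_correct, Df, Rabs_def1; lra.
  destruct (MVT_gen f p q (Derive f)) as [c [Hc1 Hc2]];
    rewrite Rmin_left, Rmax_right in * by lra.
  - intros t Ht; apply E; lra.
  - intros t Ht; apply continuity_pt_filterlim.
    apply (ex_derive_continuous (V := R_NormedModule)); eexists; apply E; lra.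
  - now exists c.
destruct (MV x (x + h)) as [c1 [Hc1 E1]]; try lra.
destruct (MV (x - h) x) as [c2 [Hc2 E2]]; try lra.
assert (K1 := K c1); rewrite (Rabs_right (c1 - x)) in K1 by lra.
assert (K2 := K c2); rewrite (Rabs_left1 (c2 - x)) in K2 by lra.
assert (G1 : Derive f x <= Derive f c1).
  specialize (K1 ltac:(lra)); apply Rabs_le_between in K1; lra.
assert (G2 : Derive f c2 <= Derive f x).
  specialize (K2 ltac:(lra)); apply Rabs_le_between in K2; lra.
assert (C1 : Rabs (x - h - x) < r) by (apply Rabs_def1; lra).
assert (C2 : Rabs (x + h - x) < r) by (apply Rabs_def1; lra).
assert (C3 : x - h <> x + h) by lra.
(* Strict concavity at the midpoint contradicts [E1] and [E2], whose slopes are compared through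
   [Derive f x]. *)
assert (C4 := Hc (x - h) (x + h) (/ 2) C1 C2 C3 ltac:(lra)).
replace (/ 2 * (x - h) + (1 - / 2) * (x + h)) with x in C4 by field.
nra.
Qed.

Theorem theorem4p1 (U : C -> Prop) (F : C -> C) (beta gamma : R) (m : nat)
  (hF : holomorphic_on U F)
  (hU : U (point beta gamma))
  (hm : zero_of_order F (point beta gamma) m) :
  (exists a0 : R, 0 < a0 /\
    forall a : R, 0 < a < a0 ->
      (twice_derivable_at (u_defined U F (beta - a)) (u F (beta - a)) gamma /\
       Derive_n (u F (beta - a)) 2 gamma > 0) /\
      (twice_derivable_at (u_defined U F (beta + a)) (u F (beta + a)) gamma /\
       Derive_n (u F (beta + a)) 2 gamma < 0)) /\
  ~ (exists delta : R, 0 < delta /\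
      forall sigma : R, beta - delta < sigma < beta + delta -> sigma <> beta ->
        forall I : R -> Prop, is_interval I ->
          (forall t : R, I t -> u_defined U F sigma t) ->
          strictly_concave_on I (u F sigma)).
Proof.
destruct (vertical_second_derivative_sign U F beta gamma m hF hU hm) as [a0 [a0pos Ha]].
assert (Hleft : forall a, 0 < a < a0 ->
  twice_derivable_at (u_defined U F (beta - a)) (u F (beta - a)) gamma /\
  Derive_n (u F (beta - a)) 2 gamma > 0).
  intros a Hlt.
  assert (Hn : - a <> 0) by lra.
  assert (Habs : Rabs (- a) < a0) by (apply Rabs_def1; lra).
  destruct (Ha (- a) Hn Habs) as [H1 H2].
  change (beta + - a) with (beta - a) in *; split; auto; nra.
split.
- exists a0; split; auto; intros a Hlt; split; [now apply Hleft |].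
  assert (Hn : a <> 0) by lra.
  assert (Habs : Rabs a < a0) by (apply Rabs_def1; lra).
  destruct (Ha a Hn Habs) as [H1 H2]; split; auto; nra.
- intros [delta [dpos Hd]].
  (* The line at [beta - a] lies in the supposed strip and close enough for the second derivative to
     be positive there. *)
  set (a := Rmin a0 delta / 2).
  assert (apos : 0 < a /\ a < a0 /\ a < delta).
    assert (0 < Rmin a0 delta) by (apply Rmin_glb_lt; auto).
    generalize (Rmin_l a0 delta) (Rmin_r a0 delta); unfold a; lra.
  destruct (Hleft a) as [[[r Hr] Hex] Hpos]; [lra |].
  apply (Rgt_not_le _ _ Hpos).
  (* The test interval is the neighbourhood of [gamma] of radius [r] on which [u] is defined and
     differentiable, as given by [twice_derivable_at]. *)
  apply (strictly_concave_second_derivative _ gamma r (cond_pos r)); auto.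
  + intros t Ht; now apply Hr.
  + apply Hd; try lra.
    * intros x y t Hx Hy Ht.
      apply Rabs_def2 in Hx; apply Rabs_def2 in Hy; apply Rabs_def1; lra.
    * intros t Ht; now apply Hr.
Qed.
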